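(* Let $r\ge1$ be a fixed integer. For each $n$ let $\pi_n$ be a uniformly random parking function of length $n$, and let $L_r(\pi_n)$ be the length of its $r$th longest cycle. Then $$\frac{\mathbb E(L_r(\pi_n))}{\sqrt n}\longrightarrow\sqrt{\frac{\pi}{2}}\;G_{r,1}\quad\text{as } n\to\infty,$$ where $$G_{r,1}:=\frac1{\Gamma(r)}\int_0^\infty E_1(x)^{r-1}e^{-E_1(x)-x}\,dx,\qquad E_1(x)=\int_x^\infty t^{-1}e^{-t}\,dt.$$
   Context: Let $[n]=\{1,\dots,n\}$. A parking function of length $n$ is a sequence $\pi_n=(\pi_n(1),\dots,\pi_n(n))\in[n]^n$ such that $|\{k\in[n]:\pi_n(k)\le i\}|\ge i$ for all $i\in[n]$. Viewing $\pi_n$ as a map $[n]\to[n]$, its digraph $G_{\pi_n}$ is the directed graph with vertex set $[n]$ and a directed edge from $i$ to $\pi_n(i)$ for every $i\in[n]$ (a fixed point gives a self-loop, which is a cycle of length $1$). $L_r(\pi_n)$ is the length of the $r$th longest directed cycle of $G_{\pi_n}$ (cycle lengths listed in weakly decreasing order with multiplicity), defined to be $0$ if $G_{\pi_n}$ has fewer than $r$ cycles. $\Gamma$ is the Gamma function. *)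

(* Defs.v *)
From mathcomp Require Import all_boot all_order all_algebra.
From mathcomp Require Import all_classical all_reals all_analysis.
Set Implicit Arguments.
Unset Strict Implicit.
Unset Printing Implicit Defensive.
Import Order.TTheory GRing.Theory Num.Theory.
Import numFieldNormedType.Exports.
Local Open Scope ring_scope.

(* [n] = {1, ..., n} is represented by 'I_n = {0, ..., n - 1}, on positions and
   on values alike, so that "#{k | pi(k) <= i} >= i for all i in [n]" is shifted
   to "#{k | f k <= i} >= i + 1 for all i : 'I_n". *)
Definition parking_functions (n : nat) : {set {ffun 'I_n -> 'I_n}} :=
  [set f : {ffun 'I_n -> 'I_n} |
    [forall i : 'I_n, (i.+1 <= #|[set k : 'I_n | (f k <= i)%N]|)%N]].

Definition digraph (n : nat) (f : {ffun 'I_n -> 'I_n}) : rel 'I_n :=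
  [rel i j | j == f i].

(* A directed cycle is a nonempty cyclic sequence of distinct vertices, up to
   rotation. As every vertex of the digraph has out-degree 1, a directed cycle
   is determined by its vertex set, which therefore represents it. *)
Definition dicycles (n : nat) (f : {ffun 'I_n -> 'I_n}) : {set {set 'I_n}} :=
  [set C : {set 'I_n} | `[< exists c : seq 'I_n,
    [/\ c != [::], ucycle (digraph f) c & C = [set:: c]] >]].

Definition dicycle_lengths (n : nat) (f : {ffun 'I_n -> 'I_n}) : seq nat :=
  sort geq [seq #|C| | C : {set 'I_n} <- enum (dicycles f)].

(* The parameter r counts from 1. *)
Definition longest_dicycle (r n : nat) (f : {ffun 'I_n -> 'I_n}) : nat :=
  nth 0%N (dicycle_lengths f) r.-1.

Definition uniform_expectation (R : realType) (T : finType) (A : {set T})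
    (X : T -> R) : R :=
  (\sum_(w in A) X w) / #|A|%:R.

Definition Gamma (R : realType) (s : R) : R :=
  (\int[@lebesgue_measure R]_(t in `]0%R, +oo[) (t `^ (s - 1) * expR (- t)))%R.

Definition E1 (R : realType) (x : R) : R :=
  (\int[@lebesgue_measure R]_(t in `]x, +oo[) (t^-1 * expR (- t)))%R.

Definition G1 (R : realType) (r : nat) : R :=
  (Gamma (r%:R : R))^-1 *
  (\int[@lebesgue_measure R]_(x in `]0%R, +oo[)
     (E1 x ^+ (r - 1) * expR (- E1 x - x)))%R.

(* Main.v *)
Require Import Defs.
From mathcomp Require Import all_boot all_order all_algebra all_fingroup.
From mathcomp Require Import boolp zify.
Set Implicit Arguments.
Unset Strict Implicit.
Unset Printing Implicit Defensive.
Import Order.TTheory GRing.Theory Num.Theory.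

(** A map f splits into its cyclic points, on which it acts as a permutation,
    and the trees hanging from them.

    Being a parking function depends only on the multiset of values, hence is
    invariant under composition on the right with a permutation.  Composing
    with permutations of the set S of cyclic points shows that, given S, a
    random parking function restricts to a uniform permutation of S
    ([card_dicycles_above]).  So the mean of L_r is the mean of a(K), where K is
    the number of cyclic points and a(k) is the mean length of the r-th longest
    cycle of a uniform permutation of k points ([expected_longest_dicycle]), and
    two facts remain: a(k) ~ G k, and E K ~ sqrt (pi n / 2).

    The mean of K is the sum over l of the mean number of invariant sets of l
    cyclic points.  The same symmetry turns this into the probability that f is
    injective on l given positions, and Pollak's circle argument ([cycle_lemma])
    computes that probability as for arbitrary maps into Z/(n+1):
    E K = sum_(1 <= l <= n) prod_(i < l) (1 - i/(n+1)), which is compared with a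
    Riemann sum of the Gaussian integral ([sum_distinct_prob_sqrt]).

    For a(k), let T_(m,r)(k) be the probability that at least r cycles are
    longer than m.  Removing the cycle of a given point gives
      (k+1) (T_(m,r)(k+1) - T_(m,r)(k)) = T_(m,r-1)(k-m) - T_(m,r)(k-m)
    for k >= m.  This has two consequences.  First, T_(dm,r)(dk) and T_(m,r)(k)
    differ by at most 1/m ([tail_prob_scale]); summing over m, a(k)/k is a Cauchy
    sequence, so a(k)/k has a limit c ([mean_len_linear]).  Knowing that the
    limit exists, its value may be read off from generating functions, with no
    Tauberian theorem.  Second, the recursion is a differential equation for the
    generating function in k, solved by the Shepp-Lloyd formula
    ([exact_gf_poisson]): if k is geometric with parameter z, the number of
    cycles longer than m is a Poisson variable with mean
    lambda_m(z) = sum_(k > m) z^k / k.  Abel summation then gives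
      c = lim_(z -> 1) (1 - z) sum_m z^m q(lambda_m(z)),
    with q(x) = x^(r-1) e^(-x) / (r-1)!.  With z = e^(-s), the weight
    (1 - z) z^m is the integral of e^(-x) over ]sm, s(m+1)], where
    lambda_m(z) is within 1/m of E_1(x); so the sum tends to the integral of
    e^(-x) q(E_1(x)), that is to G_(r,1) ([mean_len_slope]). *)

(** * Cycles of a permutation of a finite set *)

Section PermCycles.
Variable T : finType.
Implicit Types (S A B : {set T}) (s : {perm T}) (x : T) (P : {set {set T}}).

Definition num_above (m : nat) P := #|[set C in P | (m < #|C|)%N]|.

Lemma num_aboveE m P : num_above m P = (\sum_(C in P) (m < #|C|))%N.
Proof.
by rewrite /num_above -sum1dep_card big_mkcondr; apply: eq_bigr => C _; case: ltnP.
Qed.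

Definition cycles_on S s : {set {set T}} := [set porbit s x | x in S].

(** A permutation of S is a permutation of the ambient type supported in S, so
    that a cycle can be split off without changing types. *)
Definition tail_perms (m r : nat) S : {set {perm T}} :=
  [set s | perm_on S s & (r <= num_above m (cycles_on S s))%N].

(** For x in A these are the permutations of A with a single cycle. *)
Definition full_cycles x A : {set {perm T}} :=
  [set s | perm_on A s & porbit s x == A].

Lemma porbit_eq_in B (s s' : {perm T}) :
  {in B, s =1 s'} -> {in B, forall z, s z \in B} ->
  {in B, porbit s =1 porbit s'}.
Proof.
move=> ss' sB x xB.
have it i : ((s ^+ i)%g x = (s' ^+ i)%g x) /\ (s ^+ i)%g x \in B.
  elim: i => [|i [IH1 IH2]]; first by rewrite !expg0 perm1.
  by rewrite !expgSr !permM -IH1 ss' // -ss' // sB.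
apply/setP => y; apply/porbitP/porbitP => -[i ->]; exists i.
- by rewrite (it i).1.
- by rewrite -(it i).1.
Qed.

Lemma perm_onP S s : reflect (forall z, z \notin S -> s z = z) (perm_on S s).
Proof.
apply: (iffP idP) => [h z zS|h]; first exact: (out_perm h).
apply/fintype.subsetP => z; rewrite inE => sz.
by apply/negPn/negP => /h /eqP; rewrite (negPf sz).
Qed.

Section SplitOffCycle.
Variables (m r : nat) (S A : {set T}) (x : T).
Hypotheses (xA : x \in A) (AS : A \subset S).

Lemma perm_on_mulE (s1 s2 : {perm T}) : perm_on A s1 -> perm_on (S :\: A) s2 ->
  [/\ {in A, (s1 * s2)%g =1 s1}, {in ~: A, (s1 * s2)%g =1 s2} & perm_on S (s1 * s2)%g].
Proof.
move=> p1 p2; have e1 : {in A, (s1 * s2)%g =1 s1}.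
  move=> y yA; rewrite permM (out_perm p2) //.
  by rewrite !inE (perm_closed y p1) yA.
have e2 : {in ~: A, (s1 * s2)%g =1 s2}.
  by move=> y; rewrite inE => yA; rewrite permM (out_perm p1).
split=> //; apply/perm_onP => z zS.
have zA : z \notin A by apply: contra zS; apply: fintype.subsetP.
by rewrite e2 ?inE // (out_perm p2) // !inE negb_and zS orbT.
Qed.

Lemma cycles_on_mul (s1 s2 : {perm T}) :
  s1 \in full_cycles x A -> perm_on (S :\: A) s2 ->
  cycles_on S (s1 * s2)%g = A |: cycles_on (S :\: A) s2.
Proof.
rewrite inE => /andP[p1 /eqP cA] p2.
have [e1 e2 pS] := perm_on_mulE p1 p2.
have oA y : y \in A -> porbit (s1 * s2)%g y = A.
  move=> yA; rewrite (@porbit_eq_in A _ s1) //; last first.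
    by move=> z zA; rewrite e1 // perm_closed.
  by apply/eqP; rewrite -[X in _ == X]cA eq_porbit_mem cA.
have oB y : y \in S :\: A -> porbit (s1 * s2)%g y = porbit s2 y.
  move=> yB; apply: (@porbit_eq_in (S :\: A)) => // z zB; last rewrite e2 ?perm_closed //.
    by apply: e2; move: zB; rewrite !inE => /andP[].
  by move: zB; rewrite !inE => /andP[].
apply/setP => C; rewrite !inE; apply/imsetP/orP.
- move=> [y yS ->]; have [yA|yA] := boolP (y \in A); first by left; rewrite oA.
  by right; rewrite oB ?inE ?yA //; apply: imset_f; rewrite inE yA.
- case=> [/eqP ->|/imsetP[y yB ->]].
    by exists x; rewrite ?oA //; apply: (fintype.subsetP AS).
  by exists y; rewrite ?oB //; move: yB; rewrite inE => /andP[].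
Qed.

Lemma num_above_cycles_mul (s1 s2 : {perm T}) :
  s1 \in full_cycles x A -> perm_on (S :\: A) s2 ->
  num_above m (cycles_on S (s1 * s2)%g) =
  ((m < #|A|) + num_above m (cycles_on (S :\: A) s2))%N.
Proof.
move=> h1 h2; rewrite (cycles_on_mul h1 h2).
have AN : A \notin cycles_on (S :\: A) s2.
  apply/negP => /imsetP[y]; rewrite inE => /andP[yA _] eA.
  by move: yA; rewrite eA porbit_id.
by rewrite !num_aboveE big_setU1.
Qed.

(** A permutation of S in which x has cycle A is a cyclic permutation of A times
    an arbitrary permutation of the rest, and A uses up one of the r required
    cycles exactly when it is longer than m. *)
Lemma card_tail_perms_porbit :
  #|[set s in tail_perms m r S | porbit s x == A]| =
  (#|full_cycles x A| * #|tail_perms m (r - (m < #|A|)) (S :\: A)|)%N.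
Proof.
rewrite -cardsX; set X := finset.setX _ _.
rewrite -(card_in_imset (f := fun u : {perm T} * {perm T} => (u.1 * u.2)%g) (D := X)).
  apply: eq_card => s; apply/idP/imsetP.
  - rewrite !inE => /andP[/andP[pS rS] /eqP oA].
    have sA z : z \in A -> s z \in A.
      have h := mem_porbit s 1 z; rewrite expg1 in h.
      by rewrite -oA -!eq_porbit_mem => /eqP <-; rewrite eq_porbit_mem h.
    have [s1 [s1A p1]] : exists s1 : {perm T}, {in A, s1 =1 s} /\ perm_on A s1.
      have sAA : [set s z | z in A] = A.
        apply/eqP; rewrite eqEcard card_imset ?leqnn ?andbT; last exact: perm_inj.
        by apply/fintype.subsetP => _ /imsetP[z zA ->]; apply: sA.
      exists (restr_perm A s); split.
        move=> z zA; rewrite restr_permE //; apply/astabsP => y; rewrite /= ?/aperm.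
        apply/idP/idP => [|/sA //]; rewrite -{1}sAA => /imsetP[z' z'A /perm_inj ->//].
      exact: restr_perm_on.
    have c1 : s1 \in full_cycles x A.
      rewrite inE p1 /= -(@porbit_eq_in A s s1) ?oA //.
      by move=> z zA; rewrite s1A.
    have p2 : perm_on (S :\: A) (s1^-1 * s)%g.
      apply/perm_onP => z; rewrite !inE negb_and negbK => /orP[zA|zS].
        rewrite permM -s1A ?permKV // .
        by rewrite -(perm_closed _ p1) permKV.
      have zA : z \notin A by apply: contra zS; apply: fintype.subsetP.
      have e1 : s1^-1%g z = z by apply: (@perm_inj _ s1); rewrite permKV (out_perm p1).
      by rewrite permM e1; move/perm_onP: pS; apply.
    have es : s = (s1 * (s1^-1 * s))%g by rewrite mulKVg.
    exists (s1, (s1^-1 * s)%g) => //.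
    rewrite inE /= c1 inE p2 /= leq_subLR -(num_above_cycles_mul c1 p2).
    by rewrite -es.
  - move=> [[s1 s2]]; rewrite in_setX /= => /andP[c1 c2] ->.
    move: c2; rewrite inE => /andP[p2 h].
    have [p1 /eqP oA] : perm_on A s1 /\ porbit s1 x == A by move: c1; rewrite inE => /andP.
    have [e1 e2 pS] := perm_on_mulE p1 p2.
    rewrite !inE pS /= num_above_cycles_mul // -leq_subLR h /=.
    rewrite (@porbit_eq_in A _ s1) ?oA // => z zA.
    by rewrite e1 // perm_closed.
move=> [s1 s2] [t1 t2]; rewrite !inE /= => /andP[/andP[p1 _] /andP[p2 _]].
move=> /andP[/andP[q1 _] /andP[q2 _]] e.
have [e1 e2 _] := perm_on_mulE p1 p2.
have [f1 f2 _] := perm_on_mulE q1 q2.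
have E : s1 = t1.
  apply/permP => y; have [yA|yA] := boolP (y \in A); first by rewrite -e1 // e f1.
  by rewrite (out_perm p1) // (out_perm q1).
by move: e; rewrite E => /mulgI ->.
Qed.

End SplitOffCycle.

End PermCycles.

Lemma sum_subsets_mem (T : finType) (x : T) (S : {set T}) (F : nat -> nat) :
  x \in S ->
  (\sum_(A : {set T} | (x \in A) && (A \subset S)) F #|A| =
   \sum_(l < #|S|) 'C(#|S|.-1, l) * F l.+1)%N.
Proof.
move=> xS.
have [k Sk] : exists k, #|S| = k.+1 by exists #|S :\ x|; rewrite (cardsD1 x S) xS.
have cS : #|S :\ x| = k by apply: succn_inj; rewrite -Sk (cardsD1 x S) xS.
rewrite Sk /=.
rewrite (reindex_onto (fun B : {set T} => x |: B) (fun A => A :\ x)) /=; last first.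
  by move=> A /andP[xA _]; rewrite setD1K.
rewrite (eq_bigl (fun B : {set T} => B \subset S :\ x)); last first.
  move=> B; rewrite setU11 /= subUset sub1set xS /= subsetD1.
  have -> : ((x |: B) :\ x == B) = (x \notin B).
    apply/eqP/idP => [<-|xB]; first by rewrite !inE eqxx.
    by rewrite setU1K.
  by [].
rewrite (partition_big (fun B : {set T} => inord #|B| : 'I_k.+1) xpredT) //=.
apply: eq_bigr => l _.
rewrite (eq_bigl (fun B => B \in [set B : {set T} | B \subset S :\ x & #|B| == l])); last first.
  move=> B; rewrite inE; have [BS|//] := boolP (B \subset _).
  by rewrite /= -val_eqE /= inordK // ltnS -cS subset_leq_card.
rewrite (eq_bigr (fun _ => F l.+1)); last first.
  move=> B; rewrite inE subsetD1 => /andP[/andP[_ xB] /eqP <-].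
  by rewrite cardsU1 xB.
by rewrite sum_nat_const cards_draws cS.
Qed.

Section TailRec.
Variables (m : nat).

Lemma card_tail_perms_rec (T : finType) r (x : T) (S : {set T}) : x \in S ->
  #|tail_perms m r S| = (\sum_(A : {set T} | (x \in A) && (A \subset S))
    #|full_cycles x A| * #|tail_perms m (r - (m < #|A|)) (S :\: A)|)%N.
Proof.
move=> xS; rewrite -sum1_card.
rewrite (partition_big (fun s : {perm T} => porbit s x)
  (fun A => (x \in A) && (A \subset S))) /=; last first.
  move=> s; rewrite inE => /andP[ps _]; rewrite porbit_id /=.
  apply/fintype.subsetP => y /porbitP[i ->]; elim: i => [|i IH]; first by rewrite expg0 perm1.
  by rewrite expgSr permM perm_closed.
apply: eq_bigr => A /andP[xA AS]; rewrite -(card_tail_perms_porbit m r xA AS) -sum1_card.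
by apply: eq_bigl => s; rewrite !inE.
Qed.

Lemma card_tail_perms0 (T : finType) (S : {set T}) : #|tail_perms m 0 S| = (#|S|)`!.
Proof.
by rewrite -card_perm; apply: eq_card => s; rewrite inE andbT.
Qed.
End TailRec.

(** Splitting off the cycle of x counts all #|A|! permutations of A; by induction
    each smaller cycle length contributes (#|A| - 1)!, which leaves (#|A| - 1)!
    for the full cycles. *)
Lemma card_full_cycles (T : finType) (x : T) (A : {set T}) : x \in A ->
  #|full_cycles x A| = (#|A|.-1)`!.
Proof.
have [k] := ubnP #|A|; elim: k A => // k IH A; rewrite ltnS => Ak xA.
have A0 : (0 < #|A|)%N by rewrite (cardsD1 x A) xA.
have := card_tail_perms_rec 0 0 xA; rewrite card_tail_perms0.
rewrite (bigD1 A) /=; last by rewrite xA subxx.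
rewrite card_tail_perms0 setDv cards0 fact0 muln1.
pose F l := (l.-1`! * (#|A| - l)`!)%N.
rewrite (eq_bigr (fun B : {set T} => F #|B|)); last first.
  move=> B /andP[/andP[xB BA] nBA].
  have BpA : B \proper A by rewrite properEneq nBA BA.
  rewrite IH ?(leq_trans (proper_card BpA)) // card_tail_perms0 cardsD.
  by rewrite (setIidPr BA).
have := @sum_subsets_mem T x A F xA.
rewrite (bigD1 A) /=; last by rewrite xA subxx.
rewrite [F #|A|]/F subnn fact0 muln1 => E E'.
have {}E : ((#|A|.-1)`! + \sum_(i : {set T} | (x \in i) && (i \subset A) && (i != A)) F #|i| = (#|A|)`!)%N.
  rewrite E (eq_bigr (fun _ => (#|A|.-1)`!)).
    by rewrite sum_nat_const card_ord -{3}(prednK A0) factS prednK.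
  move=> l _; rewrite /F /= -[X in (X - _.+1)%N](prednK A0) subSS bin_fact //.
  by rewrite -ltnS prednK.
by apply/eqP; rewrite -(eqn_add2r (\sum_(i : {set T} | (x \in i) && (i \subset A) && (i != A)) F #|i|)) E -E'.
Qed.

(** The counts below depend on S through its size only ([card_tail_perms]), so the
    ordinals serve as the reference set of each size. *)
Definition num_tail_perms (m r k : nat) : nat := #|tail_perms m r [set: 'I_k]|.

Lemma card_tail_perms (m : nat) (T : finType) (S : {set T}) r :
  #|tail_perms m r S| = num_tail_perms m r #|S|.
Proof.
have [k] := ubnP #|S|; elim: k T S r => // k IH T S r; rewrite ltnS => Sk.
have [S0|[x xS]] := set_0Vmem S.
  have h (U : finType) : tail_perms m r (finset.set0 : {set U}) =
     if r == 0%N then [set 1%g] else finset.set0.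
    apply/setP => s; rewrite inE.
    have -> : cycles_on finset.set0 s = finset.set0 by rewrite /cycles_on imset0.
    have -> : num_above m (finset.set0 : {set {set U}}) = 0%N.
      by rewrite num_aboveE big_set0.
    have -> : perm_on finset.set0 s = (s == 1%g).
      apply/perm_onP/eqP => [h|-> z _]; last by rewrite perm1.
      by apply/permP => z; rewrite perm1 h // inE.
    by rewrite leqn0; case: (r == 0%N); rewrite ?inE ?andbT ?andbF.
  rewrite S0 /num_tail_perms cards0.
  have -> : [set: 'I_0] = finset.set0 by apply/setP => -[].
  by rewrite !h; case: (r == 0%N); rewrite ?cards0 ?cards1.
pose F l := (l.-1`! * num_tail_perms m (r - (m < l)) (#|S| - l))%N.
have main (U : finType) (S' : {set U}) (y : U) : y \in S' -> #|S'| = #|S| ->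
    #|tail_perms m r S'| = (\sum_(l < #|S|) 'C(#|S|.-1, l) * F l.+1)%N.
  move=> yS' e; rewrite (card_tail_perms_rec m r yS') -e -(@sum_subsets_mem U y S' F yS').
  apply: eq_bigr => A /andP[yA AS]; rewrite card_full_cycles // IH.
    by rewrite cardsD (setIidPr AS) /F e.
  rewrite (leq_trans _ Sk) // -e; apply: proper_card; rewrite properEneq subsetDl andbT.
  by apply/eqP => /setP /(_ y); rewrite inE yA yS'.
have S0 : (0 < #|S|)%N by apply/card_gt0P; exists x.
rewrite /num_tail_perms (main T S x xS) // (main _ _ (Ordinal S0)) ?inE //.
by rewrite cardsT card_ord.
Qed.

(** Choosing the other l points of the cycle of a given point and their cyclic order
    accounts for the factor 'C(k, l) * l`!. *)
Lemma num_tail_permsS m r k :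
  (num_tail_perms m r k.+1 =
  \sum_(l < k.+1) 'C(k, l) * (l`! * num_tail_perms m (r - (m < l.+1)) (k - l)))%N.
Proof.
have := card_tail_perms_rec m r (in_setT (ord0 : 'I_k.+1)).
have := @sum_subsets_mem _ (ord0 : 'I_k.+1) finset.setT
  (fun l => l.-1`! * num_tail_perms m (r - (m < l)) (k.+1 - l))%N (in_setT _).
rewrite cardsT card_ord /= => <- h; rewrite {1}/num_tail_perms h.
apply: eq_bigr => A /andP[xA _]; rewrite card_full_cycles // card_tail_perms.
by rewrite cardsD setTI cardsT card_ord.
Qed.

(** * Maps that permute a given set *)

Section PartialPermutations.
Variable n : nat.
Implicit Types (f g : {ffun 'I_n -> 'I_n}) (s : {perm 'I_n}) (A S : {set 'I_n}).

Definition precomp f s : {ffun 'I_n -> 'I_n} := [ffun x => f (s x)].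

Lemma precompK s : cancel (precomp^~ s) (precomp^~ s^-1%g).
Proof. by move=> f; apply/ffunP => x; rewrite !ffunE permKV. Qed.

Lemma precompVK s : cancel (precomp^~ s^-1%g) (precomp^~ s).
Proof. by move=> f; apply/ffunP => x; rewrite !ffunE permK. Qed.

Lemma parking_precomp f s :
  (precomp f s \in parking_functions n) = (f \in parking_functions n).
Proof.
rewrite !inE; apply: eq_forallb => i; congr (_ <= _)%N.
rewrite -(card_imset [set k | (precomp f s k <= i)%N] (@perm_inj _ s)).
apply: eq_card => y; rewrite inE; apply/imsetP/idP => [[x]|fy].
  by rewrite inE ffunE => h ->.
by exists (s^-1 y)%g; rewrite ?permKV // inE ffunE permKV.
Qed.

Definition agree s A f := [forall x in A, f x == s x].

Lemma agreeP s A f : reflect {in A, f =1 s} (agree s A f).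
Proof.
by apply: (iffP forall_inP) => h x xA; [apply/eqP; apply: h|apply/eqP; apply: h].
Qed.

Lemma agree_imset s A f : perm_on A s -> agree s A f -> f @: A = A.
Proof.
move=> sA /agreeP fs; rewrite (eq_in_imset fs); apply/eqP; rewrite eqEcard.
rewrite (card_imset _ (@perm_inj _ s)) leqnn andbT.
by apply/fintype.subsetP => _ /imsetP[x xA ->]; rewrite perm_closed.
Qed.

Lemma agree_inj s t A f : perm_on A s -> perm_on A t ->
  agree s A f -> agree t A f -> s = t.
Proof.
move=> sA tA /agreeP fs /agreeP ft; apply/permP => x.
have [xA|xA] := boolP (x \in A); first by rewrite -fs // ft.
by rewrite (out_perm sA) // (out_perm tA).
Qed.

Lemma agree_ex A f : f @: A = A -> exists2 s, perm_on A s & agree s A f.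
Proof.
move=> fA; have finj : {in A &, injective f} by apply/imset_injP; rewrite fA.
pose h x := if x \in A then f x else x.
have hinj : injective h.
  have hA x : (h x \in A) = (x \in A).
    rewrite /h; case: ifP => // xA.
    by have := imset_f f xA; rewrite fA => ->.
  move=> x y e; have := hA x; rewrite e hA => exy.
  move: e; rewrite /h -exy; case: ifP => // yA; apply: finj => //.
  by rewrite -exy.
exists (perm hinj); first by apply/perm_onP => z zA; rewrite permE /h (negPf zA).
by apply/agreeP => x xA; rewrite permE /h xA.
Qed.

(** A map with f @: A = A agrees on A with exactly one permutation of A. *)
Lemma sum_agree (F : {set {ffun 'I_n -> 'I_n}}) A (G : {ffun 'I_n -> 'I_n} -> nat) :
  (\sum_(f in F | f @: A == A) G f =
   \sum_(s | perm_on A s) \sum_(f in F | agree s A f) G f)%N.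
Proof.
rewrite (exchange_big_dep (mem F)) /=; last by move=> s f _ /andP[].
rewrite [RHS](bigID (fun f : {ffun _} => f @: A == A)) /= [X in _ = (_ + X)%N]big1.
  rewrite addn0; apply: eq_bigr => f /andP[fF /eqP /agree_ex[s sA fs]].
  rewrite (big_pred1 s) // => t /=; rewrite fF /=; apply/andP/eqP => [[tA ft]|-> //].
  exact: (agree_inj tA sA ft fs).
move=> f /andP[fF fA]; rewrite big1 // => s /andP[sA /andP[_ fs]].
by rewrite (agree_imset sA fs) eqxx in fA.
Qed.

(** Composing with a permutation of A changes the permutation induced on A at will
    but not the multiset of values, so every permutation of A is induced by equally
    many parking functions. *)
Lemma card_agree (Psi : pred {ffun 'I_n -> 'I_n}) A s :
  (forall f t, perm_on A t -> Psi f -> Psi (precomp f t)) -> perm_on A s ->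
  #|[set f in parking_functions n | Psi f && agree s A f]| =
  #|[set f in parking_functions n | Psi f && agree 1%g A f]|.
Proof.
move=> H sA.
rewrite -(card_imset _ (can_inj (@precompVK s))); apply: eq_card => g.
have sVA : perm_on A s^-1%g by rewrite perm_onV.
rewrite [in RHS]inE; apply/imsetP/andP.
- move=> [f]; rewrite inE => /andP[fP /andP[fPsi /agreeP fs]] ->.
  rewrite parking_precomp fP H //; split=> //=; apply/agreeP => x xA.
  by rewrite ffunE fs ?permKV ?perm1 // perm_closed.
- move=> [gP /andP[gPsi /agreeP gs]]; exists (precomp g s); last by rewrite precompK.
  rewrite inE parking_precomp gP H //=; apply/agreeP => x xA.
  by rewrite ffunE gs ?perm1 // perm_closed.
Qed.

Definition cyclic_points f : {set 'I_n} := [set x | fconnect f (f x) x].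

Lemma cyclic_pointsP f x :
  reflect (exists i, iter i.+1 f x = x) (x \in cyclic_points f).
Proof.
rewrite inE; apply: (iffP idP) => [/iter_findex e|[i e]].
  by exists (findex f (f x) x); rewrite iterSr.
by rewrite -{2}e iterSr fconnect_iter.
Qed.

Lemma agree_iter s A f x i : perm_on A s -> agree s A f -> x \in A ->
  iter i f x = (s ^+ i)%g x /\ iter i f x \in A.
Proof.
move=> sA /agreeP fs xA; elim: i => [|i [IH1 IH2]] /=; first by rewrite expg0 perm1.
by rewrite fs // perm_closed // IH2 expgSr permM IH1.
Qed.

Lemma agree_fconnect s A f x y : perm_on A s -> agree s A f -> x \in A ->
  fconnect f x y = (y \in porbit s x).
Proof.
move=> sA fs xA; apply/idP/porbitP => [/iter_findex <-|[i ->]].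
  by exists (findex f x y); rewrite (agree_iter _ sA fs xA).1.
by rewrite -(agree_iter i sA fs xA).1 fconnect_iter.
Qed.

Lemma agree_sub_cyclic s A f : perm_on A s -> agree s A f -> A \subset cyclic_points f.
Proof.
move=> sA fs; apply/fintype.subsetP => x xA; apply/cyclic_pointsP; exists #[s]%g.-1.
by rewrite prednK ?order_gt0 // (agree_iter _ sA fs xA).1 expg_order perm1.
Qed.

Lemma imset_cyclic_points f : f @: cyclic_points f = cyclic_points f.
Proof.
apply/setP => y; apply/imsetP/idP => [[x /cyclic_pointsP[i e] ->]|/cyclic_pointsP[i e]].
  by apply/cyclic_pointsP; exists i; rewrite -iterSr iterS e.
exists (iter i f y); last by rewrite -iterS e.
by apply/cyclic_pointsP; exists i; rewrite -iterD addnC iterD e.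
Qed.

(** An orbit of the new map that started outside the old cyclic points and came
    back would either avoid them, and then be an orbit of f, or enter them, and
    then never leave. *)
Lemma cyclic_points_precomp f t : perm_on (cyclic_points f) t ->
  cyclic_points (precomp f t) = cyclic_points f.
Proof.
set S := cyclic_points f => tS; set g := precomp f t.
have [s sS fs] := agree_ex (imset_cyclic_points f); rewrite -/S in sS fs.
have gs : agree (t * s)%g S g.
  by apply/agreeP => x xS; rewrite ffunE permM (agreeP _ _ _ fs) // perm_closed.
have tsS : perm_on S (t * s)%g by apply: perm_onM.
apply/eqP; rewrite eqEsubset (agree_sub_cyclic tsS gs) andbT.
apply/fintype.subsetP => x /cyclic_pointsP[i e]; apply/negPn/negP => xS.
have out j : (j <= i.+1)%N -> iter j g x \notin S.
  move=> ji; apply: contra xS => jS; rewrite -e -(subnK ji) iterD.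
  exact: (agree_iter _ tsS gs jS).2.
have fg j : (j <= i.+1)%N -> iter j g x = iter j f x.
  elim: j => // j IH ji; rewrite iterS ffunE (out_perm tS) ?out ?(ltnW ji) //.
  by rewrite IH // ltnW.
by move: xS; rewrite -[x in x \notin _]e fg // -fg // e; apply/negP/negPn/cyclic_pointsP; exists i; rewrite -fg.
Qed.

Lemma dicycles_agree s f : perm_on (cyclic_points f) s ->
  agree s (cyclic_points f) f -> dicycles f = cycles_on (cyclic_points f) s.
Proof.
set S := cyclic_points f => sS fs.
have fc c : path.cycle (digraph f) c = fcycle f c.
  by apply: eq_cycle => x y; rewrite /digraph /= eq_sym.
apply/setP => C; rewrite inE; apply/asboolP/imsetP.
- move=> [[|x c] [] // _ /andP[]]; rewrite fc => cyc _ ->.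
  have xS : x \in S.
    rewrite inE (fconnect_cycle cyc) ?mem_head //.
    by rewrite -(fconnect_cycle cyc (mem_head x c)) fconnect1.
  exists x => //; apply/setP => y.
  by rewrite -(agree_fconnect _ sS fs xS) (fconnect_cycle cyc) ?mem_head // inE.
- move=> [x xS ->]; exists (fingraph.orbit f x); split.
  + by rewrite -size_eq0 size_orbit -lt0n fingraph.order_gt0.
  + rewrite /ucycle fc orbit_uniq andbT.
    by rewrite -fconnect_f; move: xS; rewrite inE.
  + by apply/setP => y; rewrite -(agree_fconnect _ sS fs xS) inE fconnect_orbit.
Qed.

(** Given its set of cyclic points, a random parking function induces a uniform
    permutation of that set. *)
Lemma card_dicycles_above m r S :
  (#|[set f in parking_functions n |
      (cyclic_points f == S) && (r <= num_above m (dicycles f))]| * (#|S|)`!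
   = #|[set f in parking_functions n | cyclic_points f == S]| *
     num_tail_perms m r #|S|)%N.
Proof.
pose F := [set f in parking_functions n | cyclic_points f == S].
pose M := #|[set f in parking_functions n | (cyclic_points f == S) && agree 1%g S f]|.
have MF s : perm_on S s -> (\sum_(f in F | agree s S f) 1 = M)%N.
  move=> sS; rewrite sum1dep_card /M -(@card_agree (fun f => cyclic_points f == S) S s) //.
    by apply: eq_card => f; rewrite !inE andbA.
  by move=> f t tS /eqP e; rewrite cyclic_points_precomp ?e.
have FA f : f \in F -> f @: S == S.
  by rewrite inE => /andP[_ /eqP <-]; rewrite imset_cyclic_points.
have -> : #|[set f in parking_functions n | (cyclic_points f == S) &&
    (r <= num_above m (dicycles f))%N]| = (num_tail_perms m r #|S| * M)%N.
  transitivity (\sum_(f in F | f @: S == S) (r <= num_above m (dicycles f)))%N.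
    rewrite -sum1dep_card [RHS]big_mkcond [LHS]big_mkcond; apply: eq_bigr => f _.
    have -> : (f \in parking_functions n) && ((cyclic_points f == S) &&
       (r <= num_above m (dicycles f))%N) = (f \in F) && (r <= num_above m (dicycles f))%N.
      by rewrite [in RHS]inE andbA.
    by case: (boolP (f \in F)) => [/FA ->|_] //=; case: (_ <= _)%N.
  rewrite sum_agree (bigID (fun s => r <= num_above m (cycles_on S s))%N) /=.
  rewrite [X in (_ + X)%N]big1 ?addn0.
    rewrite (eq_bigr (fun => M)).
      rewrite sum_nat_const -(card_tail_perms m S r); congr (_ * _)%N.
      by apply: eq_card => s; rewrite inE.
    move=> s /andP[sS h]; rewrite -(MF s sS); apply: eq_bigr => f /andP[].
    by rewrite inE => /andP[_ /eqP e] fs; rewrite -e in sS fs h; rewrite (dicycles_agree sS fs) h.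
  move=> s /andP[sS /negPf h]; rewrite big1 // => f /andP[].
  by rewrite inE => /andP[_ /eqP e] fs; rewrite -e in sS fs h; rewrite (dicycles_agree sS fs) h.
have -> : #|[set f in parking_functions n | cyclic_points f == S]| = ((#|S|)`! * M)%N.
  transitivity (\sum_(f in F | f @: S == S) 1)%N.
    rewrite -sum1_card; apply: eq_bigl => f.
    by case: (boolP (f \in F)) => // /FA ->.
  rewrite sum_agree (eq_bigr (fun => M)) //.
  by rewrite sum_nat_const -card_perm; congr (_ * _)%N; apply: eq_card.
by rewrite mulnAC -mulnA mulnC -mulnA.
Qed.

End PartialPermutations.

(** * Pollak's circle *)

Section CycleLemma.
Variable n : nat.
Implicit Types (g : {ffun 'I_n -> 'I_n.+1}) (c : 'I_n.+1).

Definition parks_on_circle g :=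
  [forall i : 'I_n, (i.+1 <= #|[set k : 'I_n | (g k <= i)%N]|)%N].

Definition rotate c g : {ffun 'I_n -> 'I_n.+1} := [ffun k => (g k - c)%R].

(** The number of cars preferring one of the spots 0, ..., t - 1, on the circle of
    n + 1 spots unrolled to the half-line. *)
Definition cars_before g (t : nat) : nat :=
  (\sum_(j < t) #|[set k | nat_of_ord (g k) == j %% n.+1]|)%N.

Lemma cars_before_window g c i : (i <= n)%N ->
  (cars_before g (c + i.+1) = cars_before g c + #|[set k | rotate c g k <= i]|)%N.
Proof.
move=> iN; rewrite /cars_before big_split_ord /=; congr addn.
under eq_bigr do rewrite -sum1dep_card big_mkcond.
rewrite exchange_big -sum1dep_card [RHS]big_mkcond /=; apply: eq_bigr => k _.
rewrite ffunE; set v := (g k - c)%R.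
have vE : nat_of_ord v = ((g k + (n.+1 - c)) %% n.+1)%N.
  by rewrite /v /= modnDmr.
have E (j : 'I_i.+1) : (nat_of_ord (g k) == (c + j) %% n.+1)%N = (nat_of_ord j == v).
  have := ltn_ord (g k); have := ltn_ord j; have := ltn_ord c; rewrite vE.
  move: (nat_of_ord (g k)) (nat_of_ord c) (nat_of_ord j) => a b d bn di an.
  have ->: ((b + d) %% n.+1 = if b + d < n.+1 then b + d else b + d - n.+1)%N.
    case: ltnP => h; first by rewrite modn_small.
    by rewrite -{1}(subnK h) modnDr modn_small //; lia.
  have ->: ((a + (n.+1 - b)) %% n.+1 = if a < b then a + n.+1 - b else a - b)%N.
    case: ltnP => h; first by rewrite modn_small; lia.
    by rewrite (_ : (a + (n.+1 - b) = (a - b) + n.+1)%N) ?modnDr ?modn_small //; lia.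
  by case: ltnP => ?; case: ltnP => ?; apply/eqP/eqP; lia.
under eq_bigr do rewrite E.
rewrite -big_mkcond /=; have [vi|vi] := leqP v i.
  by rewrite (big_pred1 (Ordinal (vi : v < i.+1)%N)).
by rewrite big_pred0 // => j; apply/negP => /eqP e; have := ltn_ord j; rewrite e ltnS leqNgt vi.
Qed.

Lemma cars_before_full g : cars_before g n.+1 = n.
Proof.
rewrite -(add0n n.+1) (@cars_before_window g ord0 n) //.
rewrite /cars_before big_ord0 add0n -[RHS]card_ord -cardsT; apply: eq_card => k.
by rewrite !inE -ltnS ltn_ord.
Qed.

Lemma cars_before_period g t : (cars_before g (n.+1 + t) = n + cars_before g t)%N.
Proof.
rewrite -{2}(cars_before_full g) /cars_before big_split_ord /=; congr addn.
by apply: eq_bigr => j _; rewrite modnDl.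
Qed.

Lemma parks_rotateP g c : reflect
  (forall i, (i < n)%N -> (i.+1 + cars_before g c <= cars_before g (c + i.+1))%N)
  (parks_on_circle (rotate c g)).
Proof.
apply: (iffP forallP) => [h i ni|h i].
  by rewrite cars_before_window ?(ltnW ni) // addnC leq_add2l (h (Ordinal ni)).
by have := h i (ltn_ord i); rewrite cars_before_window ?(ltnW (ltn_ord i)) // addnC leq_add2l.
Qed.

(** Let Y(t) = cars_before g t - t, which drops by 1 over each turn.  Starting at c
    gives a parking function iff Y stays at or above Y(c) until the turn is complete,
    as it does for the first minimum c of Y over one turn; two starting points c < d would give
    Y(c) <= Y(d) <= Y(c + n + 1) = Y(c) - 1. *)
Lemma cycle_lemma g : (\sum_c parks_on_circle (rotate c g) = 1)%N.
Proof.
(* Lexicographic: a minimum of cars_before g c - c, and the first such c. *)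
pose key c := ((cars_before g c + (n.+1 - c)) * n.+1 + c)%N.
case: (@arg_minnP _ (ord0 : 'I_n.+1) xpredT key isT) => c _ cmin.
have Pc : parks_on_circle (rotate c g).
  apply/parks_rotateP => i ni; have [h|h] := ltnP (c + i.+1) n.+1.
    have := cmin (Ordinal h) isT; rewrite /key /=; have := ltn_ord c; nia.
  have [t et] : exists t, (c + i.+1 = n.+1 + t)%N by exists (c + i.+1 - n.+1)%N; lia.
  rewrite et cars_before_period.
  have tN : (t < n.+1)%N by have := ltn_ord c; lia.
  have := cmin (Ordinal tN) isT; rewrite /key /=; have := ltn_ord c; nia.
rewrite (bigD1 c) //= Pc big1 // => d dc; apply/eqP; rewrite eqb0; apply/negP => Pd.
have ne : nat_of_ord d != c by [].
move: Pc Pd; wlog lt : c d {dc cmin} ne / (c < d)%N.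
  move=> H Pc Pd; have [h|h] := ltnP c d; first exact: (H c d).
  by apply: (H d c) => //; [rewrite eq_sym|lia].
move=> /parks_rotateP /(_ (d - c).-1) hc /parks_rotateP /(_ (n.+1 + c - d).-1) hd.
have := ltn_ord d; have := ltn_ord c => cn dn.
have {}hc := hc ltac:(lia); have {}hd := hd ltac:(lia).
have e1 : (c + (d - c).-1.+1 = d)%N by lia.
have e2 : (d + (n.+1 + c - d).-1.+1 = n.+1 + c)%N by lia.
rewrite e1 in hc; rewrite e2 cars_before_period in hd; lia.
Qed.

(** Each rotation class contains exactly one parking function. *)
Lemma card_parks_on_circle (Psi : pred {ffun 'I_n -> 'I_n.+1}) :
  (forall c g, Psi (rotate c g) = Psi g) ->
  (#|[set g | parks_on_circle g && Psi g]| * n.+1 = #|[set g | Psi g]|)%N.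
Proof.
move=> H; have rotK c : cancel (rotate c) (rotate (- c)%R).
  by move=> g; apply/ffunP => k; rewrite !ffunE opprK subrK.
have rotVK c : cancel (rotate (- c)%R) (rotate c).
  by move=> g; apply/ffunP => k; rewrite !ffunE opprK addrK.
rewrite -[RHS]sum1dep_card.
rewrite (eq_bigr (fun g => \sum_c parks_on_circle (rotate c g))%N); last first.
  by move=> g _; rewrite cycle_lemma.
rewrite exchange_big /= (eq_bigr (fun => #|[set g | parks_on_circle g && Psi g]|)).
  by rewrite sum_nat_const card_ord mulnC.
move=> c _; rewrite (reindex_onto (rotate (- c)%R) (rotate c)) /=; last by move=> g _; apply: rotK.
rewrite -sum1dep_card big_mkcond [RHS]big_mkcond; apply: eq_bigr => g _ /=.
by rewrite rotVK eqxx andbT H; case: (Psi g); case: (parks_on_circle g).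
Qed.

Definition embed (f : {ffun 'I_n -> 'I_n}) : {ffun 'I_n -> 'I_n.+1} :=
  [ffun k => widen_ord (leqnSn n) (f k)].

Lemma card_parking (Psi : pred {ffun 'I_n -> 'I_n.+1}) :
  #|[set f in parking_functions n | Psi (embed f)]| =
  #|[set g | parks_on_circle g && Psi g]|.
Proof.
have inj : injective embed.
  move=> f f' /ffunP e; apply/ffunP => k; apply: val_inj.
  by have := e k; rewrite !ffunE => /(congr1 val).
have eP f : parks_on_circle (embed f) = (f \in parking_functions n).
  rewrite inE; apply: eq_forallb => i; congr (_ <= _)%N.
  by apply: eq_card => k; rewrite !inE ffunE.
rewrite -(card_imset _ inj); apply: eq_card => g; rewrite [in RHS]inE.
apply/imsetP/andP => [[f]|[gP gPsi]].
  by rewrite inE => /andP[fP fPsi] ->; rewrite eP.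
have gn k : (g k < n)%N.
  have n0 := leq_ltn_trans (leq0n k) (ltn_ord k).
  have pn : (n.-1 < n)%N by rewrite prednK.
  have := forallP gP (Ordinal pn); rewrite /= prednK // => h.
  have : [set k | (g k <= n.-1)%N] = [set: 'I_n].
    by apply/eqP; rewrite eqEcard finset.subsetT cardsT card_ord.
  by move/setP/(_ k); rewrite !inE => h'; apply: leq_ltn_trans h' pn.
have eg : embed [ffun k => Ordinal (gn k)] = g.
  by apply/ffunP => k; apply: val_inj; rewrite !ffunE.
by exists [ffun k => Ordinal (gn k)]; rewrite // inE eg gPsi -eP eg gP.
Qed.

End CycleLemma.

(** Stated with cardinals, so that it is a boolean invariant under rotation. *)
Definition inj_on (D R : finType) (A : {set D}) (g : {ffun D -> R}) :=
  #|g @: A| == #|A|.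

Section InjOn.
Variables (D R : finType).

(** Resampling g at x: exchanging (g, v) with (g updated to v at x, g x) is an
    involution, and for g injective on A the new value must avoid #|A| values. *)
Lemma card_inj_onU1 (A : {set D}) (x : D) : x \notin A ->
  (#|[set g : {ffun D -> R} | inj_on (x |: A) g]| * #|R| =
   #|[set g : {ffun D -> R} | inj_on A g]| * (#|R| - #|A|))%N.
Proof.
move=> xA.
pose upd (g : {ffun D -> R}) v : {ffun D -> R} := [ffun y => if y == x then v else g y].
pose sw (p : {ffun D -> R} * R) := (upd p.1 p.2, p.1 x).
have swK : involutive sw.
  move=> [g v]; rewrite /sw /= ffunE eqxx; congr pair; apply/ffunP => y.
  by rewrite !ffunE; case: eqP => [->|].
have updE g v : inj_on (x |: A) (upd g v) = inj_on A g && (v \notin g @: A).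
  rewrite /inj_on; have -> : upd g v @: (x |: A) = v |: g @: A.
    rewrite imsetU1 ffunE eqxx; congr (_ |: _); apply: eq_in_imset => y yA.
    by rewrite ffunE; case: eqP yA xA => [->->|].
  apply/eqP/andP; rewrite !cardsU1 xA.
    have := leq_imset_card g A; case: (v \in _) => /= h1 h2; first by lia.
    by split=> //; apply/eqP; lia.
  by move=> [/eqP -> ->].
transitivity (\sum_(p : {ffun D -> R} * R) inj_on (x |: A) p.1)%N.
  rewrite -(pair_bigA _ (fun (g : {ffun D -> R}) (_ : R) => inj_on (x |: A) g : nat)) /=.
  under eq_bigr do rewrite sum_nat_const.
  rewrite -big_distrr /= mulnC; congr (_ * _)%N; rewrite -sum1dep_card big_mkcond.
  by apply: eq_bigr => g _; case: inj_on.
rewrite (reindex_inj (inv_inj swK)) /=.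
rewrite -(pair_bigA _ (fun (g : {ffun D -> R}) v => inj_on (x |: A) (upd g v) : nat)) /=.
rewrite -sum1dep_card big_distrl [RHS]big_mkcond /=; apply: eq_bigr => g _.
under eq_bigr do rewrite updE.
case: (boolP (inj_on A g)) => h /=; last by rewrite big1.
rewrite mul1n -(eqP h) -[in RHS](cardsT R) -cardsDS ?subsetT // setTD -sum1_card [RHS]big_mkcond.
by apply: eq_bigr => v _; rewrite inE; case: (v \in _).
Qed.

Lemma card_inj_on (A : {set D}) :
  (#|[set g : {ffun D -> R} | inj_on A g]| * #|R| ^ #|A| = #|R| ^ #|D| * #|R| ^_ #|A|)%N.
Proof.
have [k] := ubnP #|A|; elim: k A => // k IH A; rewrite ltnS => Ak.
have [A0|[x xA]] := set_0Vmem A.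
  rewrite A0 cards0 expn0 ffactn0 !muln1 -card_ffun -cardsT; apply: eq_card => g.
  by rewrite !inE /inj_on imset0 !cards0.
have cA : #|A| = #|A :\ x|.+1 by rewrite (cardsD1 x A) xA.
have xN : x \notin A :\ x by rewrite !inE eqxx.
have := card_inj_onU1 xN; rewrite setD1K // cA expnS mulnA => ->.
rewrite ffactnSr mulnAC IH; last by rewrite -cA.
by rewrite mulnA.
Qed.

End InjOn.

Lemma card_parking_inj_on n (A : {set 'I_n}) :
  (#|[set f in parking_functions n | inj_on A f]| * n.+1 * n.+1 ^ #|A| =
   n.+1 ^ n * n.+1 ^_ #|A|)%N.
Proof.
have -> : [set f in parking_functions n | inj_on A f] =
          [set f in parking_functions n | inj_on A (embed f)].
  apply/setP => f; rewrite !inE; congr (_ && _); rewrite /inj_on.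
  have -> : embed f @: A = widen_ord (leqnSn n) @: (f @: A).
    by rewrite -imset_comp; apply: eq_imset => k; rewrite ffunE.
  have wi : injective (widen_ord (leqnSn n)) by move=> i j /(congr1 val) /= /val_inj.
  by rewrite (card_imset _ wi).
rewrite card_parking card_parks_on_circle; last first.
  move=> c g; rewrite /inj_on.
  have -> : rotate c g @: A = (fun v => v - c)%R @: (g @: A).
    by rewrite -imset_comp; apply: eq_imset => k; rewrite ffunE.
  by rewrite (card_imset _ (@addIr _ (- c)%R)).
by have := card_inj_on 'I_n.+1 A; rewrite !card_ord.
Qed.

Lemma card_parking_functions n : (#|parking_functions n| * n.+1 = n.+1 ^ n)%N.
Proof.
have := card_parking_inj_on (finset.set0 : {set 'I_n}).
rewrite cards0 expn0 ffactn0 !muln1 => <-; congr (_ * _)%N; apply: eq_card => f.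
by rewrite [in RHS]inE /inj_on imset0 !cards0 andbT.
Qed.

Lemma prob_parking_inj_on n (A : {set 'I_n}) :
  (#|[set f in parking_functions n | inj_on A f]| * n.+1 ^ #|A| =
   #|parking_functions n| * n.+1 ^_ #|A|)%N.
Proof.
apply/eqP; rewrite -(eqn_pmul2r (isT : 0 < n.+1)%N) mulnAC card_parking_inj_on.
by rewrite mulnAC card_parking_functions.
Qed.

(** * The expected number of cyclic points *)

Lemma perm_imset (T : finType) (A B : {set T}) : #|A| = #|B| ->
  exists s : {perm T}, s @: A = B.
Proof.
move=> AB.
pose sA := enum A ++ enum (~: A); pose sB := enum B ++ enum (~: B).
have cat_all (C : {set T}) y : y \in enum C ++ enum (~: C).
  by rewrite mem_cat !mem_enum inE orbN.
have cat_uniq (C : {set T}) : uniq (enum C ++ enum (~: C)).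
  rewrite cat_uniq !enum_uniq andbT /=; apply/hasPn => y.
  by rewrite !mem_enum inE.
have szE : size sA = size sB by rewrite !size_cat -!cardE !cardsC.
have ltB y : (index y sA < size sB)%N by rewrite -szE index_mem cat_all.
pose h x := nth x sB (index x sA).
have hinj : injective h.
  move=> x y; rewrite /h (set_nth_default x y) // => /eqP.
  rewrite nth_uniq // => [/eqP e|]; last exact: cat_uniq.
  by rewrite -(nth_index x (cat_all A x)) -/sA e nth_index // cat_all.
exists (perm hinj); apply/eqP; rewrite eqEcard (card_imset _ (@perm_inj _ _)) AB leqnn andbT.
apply/fintype.subsetP => _ /imsetP[x xA ->]; rewrite permE /h nth_cat.
have xs : (index x sA < size (enum B))%N.
  rewrite /sA index_cat mem_enum xA (leq_trans _ (eq_leq (_ : size (enum A) = _))) //.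
    by rewrite index_mem mem_enum.
  by rewrite -!cardE.
by rewrite xs -(mem_enum (mem B)) mem_nth.
Qed.

Section CountCyclicPoints.
Variable n : nat.
Implicit Types (f : {ffun 'I_n -> 'I_n}) (A B : {set 'I_n}).

Let PF := parking_functions n.
Let fixing A := #|[set f in PF | agree 1%g A f]|.

Lemma sum_agree_fixing A s : perm_on A s -> (\sum_(f in PF | agree s A f) 1)%N = fixing A.
Proof.
move=> sA; rewrite sum1dep_card.
have := @card_agree n xpredT A s (fun _ _ _ _ => isT) sA.
by rewrite /fixing => e; apply: etrans e _.
Qed.

Lemma card_imset_eq A : #|[set f in PF | f @: A == A]| = ((#|A|)`! * fixing A)%N.
Proof.
rewrite -sum1dep_card (sum_agree PF A (fun=> 1%N)) (eq_bigr (fun=> fixing A)).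
  by rewrite sum_nat_const -card_perm; congr (_ * _)%N; apply: eq_card.
by move=> s; apply: sum_agree_fixing.
Qed.

Definition reach f x := [set y | fconnect f x y].

(** For x in A, these are the maps inducing one of the (#|A| - 1)! cyclic
    permutations of A. *)
Lemma card_cycle_eq A x : x \in A ->
  #|[set f in PF | (x \in cyclic_points f) && (reach f x == A)]| =
  ((#|A|.-1)`! * fixing A)%N.
Proof.
move=> xA.
have H f : (x \in cyclic_points f) && (reach f x == A) -> f @: A == A.
  move=> /andP[xc /eqP <-]; have [s ss fs] := agree_ex (imset_cyclic_points f).
  rewrite eqEsubset; apply/andP; split; apply/fintype.subsetP => y.
    by move=> /imsetP[z]; rewrite !inE => xz ->; apply: connect_trans xz (fconnect1 _ _).
  rewrite inE (agree_fconnect _ ss fs xc) => /porbitP[[|i] e].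
    apply/imsetP; move: xc => /cyclic_pointsP[j ej]; exists (iter j f x).
      by rewrite inE fconnect_iter.
    by rewrite -iterS ej e expg0 perm1.
  apply/imsetP; exists (iter i f x); first by rewrite inE fconnect_iter.
  by rewrite -iterS (agree_iter _ ss fs xc).1.
transitivity (\sum_(f in PF | f @: A == A)
   ((x \in cyclic_points f) && (reach f x == A)))%N.
  rewrite -sum1dep_card [RHS]big_mkcond [LHS]big_mkcond; apply: eq_bigr => f _.
  case: (boolP (_ && (_ == A))) => h; last by rewrite !andbF; case: ifP.
  by rewrite (H _ h) !andbT.
rewrite sum_agree (bigID (fun s => porbit s x == A)) /= [X in (_ + X)%N]big1 ?addn0.
  rewrite (eq_bigr (fun=> fixing A)).
    rewrite sum_nat_const -(card_full_cycles xA); congr (_ * _)%N.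
    by apply: eq_card => s; rewrite inE.
  move=> s /andP[sA /eqP oA]; rewrite -(sum_agree_fixing sA).
  apply: eq_bigr => f /andP[_ fs].
  rewrite (fintype.subsetP (agree_sub_cyclic sA fs) _ xA) /=.
  suff -> : reach f x = A by rewrite eqxx.
  by apply/setP => y; rewrite inE (agree_fconnect _ sA fs xA) oA.
move=> s /andP[sA /negPf oA]; rewrite big1 // => f /andP[_ fs].
suff -> : reach f x = porbit s x by rewrite oA andbF.
by apply/setP => y; rewrite inE (agree_fconnect _ sA fs xA).
Qed.

(** A set A is a cycle for (#|A| - 1)! of the #|A|! permutations of A.  Counting the
    pairs of a cyclic point and its cycle restores the factor #|A|, so that, in
    total over the parking functions, there are as many cyclic points as nonempty
    sets A with f @: A = A. *)
Lemma sum_card_cyclic_points_invariant :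
  (\sum_(f in PF) #|cyclic_points f| =
   \sum_(A : {set 'I_n} | A != finset.set0) #|[set f in PF | f @: A == A]|)%N.
Proof.
transitivity (\sum_(f in PF) \sum_(x | x \in cyclic_points f) 1)%N.
  by apply: eq_bigr => f _; rewrite sum1_card.
rewrite (exchange_big_dep xpredT) //=.
transitivity (\sum_(x : 'I_n) \sum_(A : {set 'I_n} | x \in A) ((#|A|.-1)`! * fixing A))%N.
  apply: eq_bigr => x _.
  rewrite (partition_big (fun f => reach f x) (fun A => x \in A)) /=; last first.
    by move=> f _; rewrite inE connect0.
  apply: eq_bigr => A xA; rewrite -(card_cycle_eq xA) -sum1dep_card.
  by apply: eq_bigl => f; rewrite andbA.
rewrite (exchange_big_dep xpredT) //= [RHS]big_mkcond; apply: eq_bigr => A _.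
rewrite sum_nat_const card_imset_eq; case: eqP => [->|/eqP A0] /=; first by rewrite cards0.
by rewrite mulnA -{1}(prednK (_ : 0 < #|A|)%N) ?card_gt0 // -factS prednK // card_gt0.
Qed.

(** Composing with a permutation that maps A onto B moves the domain without
    changing the set of values. *)
Lemma card_imset_eq_shift A B : #|A| = #|B| ->
  #|[set f in PF | f @: A == B]| = #|[set f in PF | f @: B == B]|.
Proof.
move=> /perm_imset[s sA].
rewrite -(card_imset _ (can_inj (@precompVK n s))); apply: eq_card => g.
rewrite [in RHS]inE; apply/imsetP/andP => [[f]|[gP gB]].
  rewrite inE => /andP[fP /eqP fB] ->; rewrite parking_precomp; split=> //.
  rewrite -{1}sA -imset_comp; apply/eqP; rewrite -[RHS]fB; apply: eq_imset => x.
  by rewrite /= ffunE permK.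
exists (precomp g s); last by rewrite precompK.
rewrite inE parking_precomp gP /= -(eqP gB) -{1}sA -imset_comp; apply/eqP.
by apply: eq_imset => x; rewrite ffunE.
Qed.

End CountCyclicPoints.

Lemma card_initial n (l : 'I_n) : #|[set i : 'I_n | (i <= l)%N]| = l.+1.
Proof.
rewrite -sum1dep_card; have := big_ord_widen n (fun=> 1%N) (ltn_ord l).
by move=> /(_ 0%N addn) <-; rewrite sum_nat_const card_ord muln1.
Qed.

Lemma sum_card_cyclic_points n :
  (\sum_(f in parking_functions n) #|cyclic_points f| =
   \sum_(l < n) #|[set f in parking_functions n |
      inj_on [set i : 'I_n | (i <= l)%N] f]|)%N.
Proof.
rewrite sum_card_cyclic_points_invariant.
case: n => [|k].
  by rewrite big_ord0 big1 // => A /set0Pn[[]].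
rewrite (partition_big (fun A : {set 'I_k.+1} => inord #|A|.-1 : 'I_k.+1) xpredT) //=.
apply: eq_bigr => l _.
set L := [set i : 'I_k.+1 | (i <= l)%N]; have cL : #|L| = l.+1 by exact: card_initial.
rewrite (eq_bigl (fun A : {set 'I_k.+1} => #|A| == l.+1)); last first.
  move=> A; rewrite -card_gt0 -val_eqE /=; case: (posnP #|A|) => [->//|A0 /=].
  have := max_card A; rewrite card_ord => Ak.
  by rewrite inordK ?(prednK A0) // -[in RHS](prednK A0) eqSS.
rewrite -[RHS]sum1dep_card (partition_big (fun f : {ffun 'I_k.+1 -> 'I_k.+1} => f @: L)
  (fun A => #|A| == l.+1)) /=; last by move=> f /andP[_ /eqP ->]; rewrite cL.
apply: eq_bigr => A /eqP cA; rewrite -(@card_imset_eq_shift _ L) ?cL ?cA //.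
rewrite -sum1dep_card; apply: eq_bigl => f.
by rewrite /inj_on; case: eqP => [->|]; rewrite ?andbF // cA cL eqxx !andbT.
Qed.

Lemma nth_sorted_geq (t : seq nat) m i : sorted geq t ->
  (m < nth 0 t i)%N = (i < count (fun x => m < x) t)%N.
Proof.
elim: t i => [|x t IH] i /=; first by rewrite nth_nil !ltn0.
rewrite (path_sortedE (rev_trans leq_trans)) => /andP[/allP xt st].
have cnt0 : (x <= m)%N -> count (fun y => m < y)%N t = 0%N.
  move=> xm; apply/eqP; rewrite -leqn0 leqNgt -has_count; apply/hasPn => y /xt yx.
  by rewrite -leqNgt (leq_trans yx xm).
have [h|h] := ltnP m x; first by case: i => [|i] /=; rewrite ?IH // add1n ltnS.
case: i => [|i] /=; rewrite ?IH // cnt0 // addn0.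
by rewrite ltnNge h.
Qed.

Lemma longest_dicycle_gt r n (f : {ffun 'I_n -> 'I_n}) m : (1 <= r)%N ->
  (m < longest_dicycle r f)%N = (r <= num_above m (dicycles f))%N.
Proof.
case: r => // r _; rewrite /longest_dicycle /= nth_sorted_geq; last first.
  by apply: sort_sorted => x y; apply: leq_total.
congr (_ < _)%N; rewrite /dicycle_lengths count_sort count_map.
rewrite /num_above -sum1_count -sum1dep_card [LHS]big_enum_cond /=.
by apply: eq_bigl => C; rewrite inE.
Qed.

(** Layer-cake formula; a cycle has at most n points. *)
Lemma longest_dicycleE r n (f : {ffun 'I_n -> 'I_n}) : (1 <= r)%N ->
  longest_dicycle r f = (\sum_(m < n) (r <= num_above m (dicycles f)))%N.
Proof.
move=> r0; have Ln : (longest_dicycle r f <= n)%N.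
  rewrite leqNgt longest_dicycle_gt // -ltnNge (leq_trans _ r0) // ltnS leqn0.
  rewrite cards_eq0; apply/eqP/setP => C; rewrite !inE; apply/negP => /andP[_].
  by rewrite ltnNge -[X in (_ <= X)%N]card_ord max_card.
under eq_bigr do rewrite -longest_dicycle_gt //.
move: (longest_dicycle r f) Ln => l ln.
rewrite -(subnK ln) addnC big_split_ord /=.
rewrite (eq_bigr (fun=> 1%N)); last by move=> i _; rewrite ltn_ord.
rewrite sum_nat_const card_ord muln1 big1 ?addn0 // => i _.
by rewrite ltnNge leq_addr.
Qed.

From mathcomp Require Import all_classical all_reals all_analysis.
From mathcomp Require Import measurable_realfun ring lra.
Import numFieldNormedType.Exports.
Local Open Scope ring_scope.

(** * Cycle lengths of a uniform permutation *)

Lemma sum_blocks (V : nmodType) d k (F : nat -> V) :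
  \sum_(j < d * k) F j = \sum_(j < k) \sum_(i < d) F (d * j + i)%N.
Proof.
elim: k => [|k IH]; first by rewrite muln0 !big_ord0.
by rewrite mulnSr big_split_ord /= IH big_ord_recr.
Qed.

Section TailProb.
Variable R : realType.
Implicit Types (m r k : nat).

(** The probability that a uniform permutation of k points has at least r cycles
    longer than m. *)
Definition tail_prob m r k : R := (num_tail_perms m r k)%:R / k`!%:R.

Lemma num_tail_perms0 m k : num_tail_perms m 0 k = k`!.
Proof. by rewrite /num_tail_perms card_tail_perms0 cardsT card_ord. Qed.

Lemma tail_prob0 m k : tail_prob m 0 k = 1.
Proof. by rewrite /tail_prob num_tail_perms0 divff // pnatr_eq0 -lt0n fact_gt0. Qed.

Lemma num_tail_perms_le m r k : (num_tail_perms m r.+1 k <= num_tail_perms m r k)%N.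
Proof.
apply: subset_leq_card; apply/fintype.subsetP => s; rewrite !inE => /andP[->] /= h.
exact: ltnW.
Qed.

Lemma tail_prob_le m r k : tail_prob m r.+1 k <= tail_prob m r k.
Proof.
by rewrite /tail_prob ler_pM2r ?invr_gt0 ?ltr0n ?fact_gt0 // ler_nat num_tail_perms_le.
Qed.

Lemma tail_prob_ge0 m r k : 0 <= tail_prob m r k.
Proof. by rewrite /tail_prob divr_ge0. Qed.

Lemma tail_prob_le1 m r k : tail_prob m r k <= 1.
Proof. by elim: r => [|r IH]; [rewrite tail_prob0|apply: le_trans (tail_prob_le _ _ _) IH]. Qed.

Lemma tail_prob_antitone m m' r k : (m <= m')%N -> tail_prob m' r k <= tail_prob m r k.
Proof.
move=> mm; rewrite /tail_prob ler_pM2r ?invr_gt0 ?ltr0n ?fact_gt0 // ler_nat.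
apply: subset_leq_card; apply/fintype.subsetP => s; rewrite !inE => /andP[->] /= h.
apply: leq_trans h _; apply: subset_leq_card; apply/fintype.subsetP => C.
by rewrite !inE => /andP[-> /=]; apply: leq_ltn_trans.
Qed.

Lemma tail_prob_eq0 m r k : (0 < r)%N -> (k <= m)%N -> tail_prob m r k = 0.
Proof.
move=> r0 km; rewrite /tail_prob (_ : num_tail_perms m r k = 0%N) ?mul0r //.
apply/eqP; rewrite cards_eq0; apply/eqP/setP => s; rewrite !inE.
apply/negP => /andP[_]; rewrite leqNgt (leq_ltn_trans _ r0) // leqn0 cards_eq0.
apply/eqP/setP => C; rewrite !inE; apply/negP => /andP[_].
by rewrite ltnNge (leq_trans _ km) // -[X in (_ <= X)%N]card_ord max_card.
Qed.

(** The length k - j of the cycle of a given point is uniform on 1, ..., k. *)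
Lemma tail_prob_rec m r k :
  k%:R * tail_prob m r k = \sum_(j < k) tail_prob m (r - (j + m < k)) j.
Proof.
case: k => [|k]; first by rewrite big_ord0 mul0r.
rewrite (reindex_inj rev_ord_inj) /= /tail_prob num_tail_permsS factS natrM.
have kf : (k`!%:R != 0 :> R) by rewrite pnatr_eq0 -lt0n fact_gt0.
have k1 : (k.+1%:R != 0 :> R) by rewrite pnatr_eq0.
rewrite (_ : forall x : R, k.+1%:R * (x / (k.+1%:R * k`!%:R)) = x / k`!%:R); last first.
  by move=> x; field; rewrite addrC -natr1 in k1 *; rewrite k1 kf.
rewrite natr_sum mulr_suml; apply: eq_bigr => l _; rewrite subSS.
have lk : (l <= k)%N by rewrite -ltnS.
rewrite (_ : (k - l + m < k.+1)%N = (m < l.+1)%N); last by apply/idP/idP; lia.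
have := bin_fact lk => /(congr1 (fun x => x%:R : R)); rewrite !natrM => <-.
have h1 : (l`!%:R != 0 :> R) by rewrite pnatr_eq0 -lt0n fact_gt0.
have h2 : ((k - l)`!%:R != 0 :> R) by rewrite pnatr_eq0 -lt0n fact_gt0.
have h3 : ('C(k, l)%:R != 0 :> R) by rewrite pnatr_eq0 -lt0n bin_gt0.
by field; rewrite h1 h2 h3.
Qed.

(** From k to k + 1 the sum in [tail_prob_rec] gains the term j = k, and among the
    old terms only j = k - m changes, its cycle having just become longer than m. *)
Lemma tail_prob_diff m r k :
  k.+1%:R * (tail_prob m r k.+1 - tail_prob m r k) =
  if (m <= k)%N then tail_prob m r.-1 (k - m) - tail_prob m r (k - m) else 0.
Proof.
rewrite mulrBr tail_prob_rec -natr1 mulrDl mul1r.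
rewrite tail_prob_rec big_ord_recr /=.
pose D j := tail_prob m r.-1 j - tail_prob m r j.
have -> : \sum_(j < k) tail_prob m (r - (j + m < k.+1)) j =
  \sum_(j < k) tail_prob m (r - (j + m < k)) j + \sum_(j < k) (if (j + m == k)%N then D j else 0).
  rewrite -big_split /=; apply: eq_bigr => j _; rewrite ltnS.
  case: (ltngtP (j + m)%N k) => h /=; rewrite ?addr0 //.
  by rewrite subn0 subn1 /D addrC subrK.
have -> : tail_prob m (r - (k + m < k.+1)) k = tail_prob m r k + (if (k + m == k)%N then D k else 0).
  rewrite (_ : (k + m < k.+1)%N = (m == 0%N)); last by apply/idP/idP; lia.
  rewrite (_ : (k + m == k)%N = (m == 0%N)); last by apply/idP/idP; lia.
  by case: (m == 0%N); rewrite ?subn0 ?addr0 // subn1 /D addrC subrK.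
rewrite (_ : forall a b c d : R, a + b + (c + d) - (a + c) = b + d); last by move=> *; ring.
have -> : \sum_(j < k) (if (j + m == k)%N then D j else 0) +
   (if (k + m == k)%N then D k else 0) = \sum_(j < k.+1) (if (j + m == k)%N then D j else 0).
  by rewrite big_ord_recr.
case: leqP => mk.
  have lt : (k - m < k.+1)%N by lia.
  rewrite (bigD1 (Ordinal lt)) //= subnK // eqxx big1 ?addr0 // => j ne.
  by case: eqP => // e; case/eqP: ne; apply: val_inj => /=; lia.
by rewrite big1 // => j _; case: eqP => // e; lia.
Qed.

Lemma tail_prob_pred_le m r k : tail_prob m r k <= tail_prob m r.-1 k.
Proof. by case: r => [|r] /=; rewrite ?tail_prob_le. Qed.

Lemma tail_prob_incr m r k : tail_prob m r k <= tail_prob m r k.+1 <= tail_prob m r k + k.+1%:R^-1.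
Proof.
have k0 : (0 : R) < k.+1%:R by rewrite ltr0n.
have := tail_prob_diff m r k; set c := (if _ then _ else _) => e.
have : 0 <= c <= 1.
  rewrite /c; case: ifP => _; last by rewrite lexx ler01.
  have := tail_prob_pred_le m r (k - m); have := tail_prob_le1 m r.-1 (k - m).
  have := tail_prob_ge0 m r (k - m); lra.
have -> : tail_prob m r k.+1 = tail_prob m r k + c / k.+1%:R by rewrite -e mulrC mulKf ?gt_eqF // addrC subrK.
move=> /andP[c0 c1]; rewrite lerDl divr_ge0 ?ler0n //= lerD2l.
by rewrite -[leRHS]mul1r ler_pM2r ?invr_gt0.
Qed.

Lemma tail_prob_incrn m r k i : tail_prob m r k <= tail_prob m r (k + i) <= tail_prob m r k + i%:R / k.+1%:R.
Proof.
elim: i => [|i /andP[IH1 IH2]]; first by rewrite addn0 mul0r addr0 lexx.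
have /andP[h1 h2] := tail_prob_incr m r (k + i); rewrite addnS; apply/andP; split.
  exact: le_trans IH1 h1.
apply: le_trans h2 _; rewrite -[i.+1]addn1 natrD mulrDl mul1r addrA lerD //.
by rewrite lef_pV2 ?posrE ?ltr0n // ler_nat ltnS leq_addr.
Qed.

(** In [tail_prob_rec] at (dm, dk) the indices d j + i with i < d form a block that
    corresponds to the index j at (m, k), and long cycles correspond to long
    cycles.  Within a block the probabilities vary by at most 1/j, and they vanish
    for j < m.  If the claim holds below k, the j-th error is therefore at most
    (1/m - 1/j) + 1/j = 1/m, and only for j >= m. *)
Lemma tail_prob_scale_rec d m r k : (0 < d)%N -> (0 < m)%N ->
  `|tail_prob (d * m) r (d * k) - tail_prob m r k| * k%:R <= (k - m)%N%:R / m%:R.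
Proof.
move=> d0 m0; have [K] := ubnP k; elim: K k r => // K IH k r; rewrite ltnS => kK.
have m0R : (0 : R) < m%:R by rewrite ltr0n.
have d0R : (0 : R) < d%:R by rewrite ltr0n.
have term j i q : (j < k)%N -> (i < d)%N ->
    `|tail_prob (d * m) q (d * j + i) - tail_prob m q j| <= (m <= j)%N%:R / m%:R.
  move=> jk id; have [mj|jm] := leqP m j; last first.
    rewrite mul0r normr_le0; case: q => [|q]; first by rewrite !tail_prob0 subrr.
    rewrite !tail_prob_eq0 ?subrr //; first exact: ltnW.
    by nia.
  rewrite mul1r.
  have j0 : (0 : R) < j%:R by rewrite ltr0n (leq_trans m0).
  have h1 : `|tail_prob (d * m) q (d * j) - tail_prob m q j| <= m%:R^-1 - j%:R^-1.
    have := IH j q (leq_trans jk kK); rewrite -ler_pdivlMr // natrB // => /le_trans; apply.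
    by rewrite le_eqVlt; apply/orP; left; apply/eqP; field; rewrite !gt_eqF.
  have /andP[h2 h3] := tail_prob_incrn (d * m) q (d * j) i.
  have h4 : i%:R / (d * j).+1%:R <= j%:R^-1 :> R.
    rewrite ler_pdivrMr ?ltr0n // ler_pdivlMl // -natrM ler_nat; nia.
  have -> : tail_prob (d * m) q (d * j + i) - tail_prob m q j =
     (tail_prob (d * m) q (d * j + i) - tail_prob (d * m) q (d * j)) + (tail_prob (d * m) q (d * j) - tail_prob m q j) by ring.
  apply: le_trans (ler_normD _ _) _.
  rewrite (ger0_norm (_ : 0 <= tail_prob (d * m) q (d * j + i) - _)) ?subr_ge0 //.
  move: h1 h2 h3 h4.
  move: (m%:R^-1 : R) (j%:R^-1 : R) (i%:R / (d * j).+1%:R : R) => x y z; lra.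
have E : d%:R * (k%:R * (tail_prob (d * m) r (d * k) - tail_prob m r k)) =
   \sum_(j < k) \sum_(i < d) (tail_prob (d * m) (r - (j + m < k)) (d * j + i) - tail_prob m (r - (j + m < k)) j).
  rewrite !mulrBr mulrA -natrM tail_prob_rec tail_prob_rec.
  rewrite (_ : \sum_(j < d * k) _ = \sum_(j < k) \sum_(i < d) tail_prob (d * m) (r - (j + m < k)) (d * j + i)).
    rewrite mulr_sumr -sumrB; apply: eq_bigr => j _.
    by rewrite sumrB sumr_const card_ord mulr_natl.
  rewrite (sum_blocks d k (fun j => tail_prob (d * m) (r - (j + d * m < d * k)) j)).
  apply: eq_bigr => j _; apply: eq_bigr => i _; congr (tail_prob _ (r - _) _).
  have := ltn_ord i => id; congr nat_of_bool.
  by apply/idP/idP => h; nia.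
have E2 : d%:R * (`|tail_prob (d * m) r (d * k) - tail_prob m r k| * k%:R) <=
    d%:R * \sum_(j < k) (m <= j)%N%:R / m%:R.
  rewrite -[d%:R in leLHS]gtr0_norm // -[k%:R in leLHS]ger0_norm // -!normrM.
  rewrite [_ * k%:R]mulrC E; apply: le_trans (ler_norm_sum _ _ _) _.
  rewrite mulr_sumr; apply: ler_sum => j _.
  apply: le_trans (ler_norm_sum _ _ _) _.
  rewrite mulr_natl -[X in _ *+ X]card_ord -sumr_const.
  by apply: ler_sum => i _; apply: term.
rewrite -(ler_pM2l d0R); apply: le_trans E2 _; rewrite ler_pM2l //.
rewrite -mulr_suml ler_pM2r ?invr_gt0 // -natr_sum ler_nat.
rewrite -(big_mkord xpredT (fun j => nat_of_bool (m <= j)))%N.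
elim: (k) => [|k' IH']; first by rewrite big_geq.
rewrite big_nat_recr //=; case: leqP => h; rewrite ?addn0 /=; lia.
Qed.

Lemma tail_prob_scale d m r k : (0 < d)%N -> (0 < m)%N ->
  `|tail_prob (d * m) r (d * k) - tail_prob m r k| <= m%:R^-1.
Proof.
move=> d0 m0; case: k => [|k].
  have T0 q : tail_prob q r 0 = (r == 0%N)%:R.
    by case: r => [|r]; rewrite ?tail_prob0 ?tail_prob_eq0.
  by rewrite muln0 !T0 subrr normr0 invr_ge0.
have k0 : (0 : R) < k.+1%:R by rewrite ltr0n.
rewrite -(ler_pM2r k0); apply: le_trans (tail_prob_scale_rec r k.+1 d0 m0) _.
by rewrite [leRHS]mulrC ler_pM2r ?invr_gt0 ?ltr0n // ler_nat leq_subr.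
Qed.

(** The mean length of the r-th longest cycle, by the layer-cake formula. *)
Definition mean_len r k : R := \sum_(m < k) tail_prob m r k.

Definition harmonic_sum k : R := \sum_(m < k) m.+1%:R^-1.

(** [tail_prob_scale] summed over m; the block m = 0 costs at most 1. *)
Lemma mean_len_scale r d k : (0 < r)%N -> (0 < d)%N ->
  `|mean_len r (d * k) - d%:R * mean_len r k| <= d%:R * (1 + harmonic_sum k).
Proof.
move=> r0 d0; case: k => [|k].
  by rewrite muln0 /mean_len /harmonic_sum !big_ord0 mulr0 subrr normr0 addr0 mulr1.
have d0R : (0 : R) < d%:R by rewrite ltr0n.
have up : mean_len r (d * k.+1) <= d%:R * \sum_(m < k.+1) tail_prob (d * m) r (d * k.+1).
  rewrite /mean_len (sum_blocks d k.+1 (fun m => tail_prob m r _)) mulr_sumr.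
  apply: ler_sum => m _; rewrite mulr_natl -[X in _ *+ X]card_ord -sumr_const.
  by apply: ler_sum => i _; apply: tail_prob_antitone; apply: leq_addr.
have low : d%:R * \sum_(m < k.+1) tail_prob (d * m.+1) r (d * k.+1) <= mean_len r (d * k.+1).
  rewrite /mean_len (sum_blocks d k.+1 (fun m => tail_prob m r _)) mulr_sumr.
  apply: ler_sum => m _; rewrite mulr_natl -[X in _ *+ X]card_ord -sumr_const.
  by apply: ler_sum => i _; apply: tail_prob_antitone; have := ltn_ord i; nia.
have h (m : 'I_k.+1) := @tail_prob_scale d m.+1 r k.+1 d0 isT.
have hS : harmonic_sum k.+1 = \sum_(m < k.+1) m.+1%:R^-1 by [].
have mS : \sum_(m < k.+1) tail_prob m.+1 r k.+1 = \sum_(m < k) tail_prob m.+1 r k.+1.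
  by rewrite big_ord_recr /= [X in _ + X]tail_prob_eq0 ?addr0.
have m0 : mean_len r k.+1 = tail_prob 0 r k.+1 + \sum_(m < k) tail_prob m.+1 r k.+1.
  by rewrite /mean_len big_ord_recl.
have low2 : mean_len r k.+1 - 1 - harmonic_sum k.+1 <= \sum_(m < k.+1) tail_prob (d * m.+1) r (d * k.+1).
  rewrite m0 hS.
  have : \sum_(m < k.+1) (tail_prob m.+1 r k.+1 - m.+1%:R^-1) <= \sum_(m < k.+1) tail_prob (d * m.+1) r (d * k.+1).
    by apply: ler_sum => m _; have := h m; rewrite ler_distl => /andP[].
  rewrite sumrB mS; have := tail_prob_le1 0 r k.+1; lra.
have up2 : \sum_(m < k.+1) tail_prob (d * m) r (d * k.+1) <= 1 + mean_len r k.+1 + harmonic_sum k.+1.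
  rewrite big_ord_recl m0.
  have h1 : \sum_(m < k) tail_prob (d * m.+1) r (d * k.+1) <=
         \sum_(m < k) (tail_prob m.+1 r k.+1 + m.+1%:R^-1).
    by apply: ler_sum => m _; have := h (widen_ord (leqnSn k) m); rewrite ler_distl => /andP[].
  have h2 : \sum_(m < k) m.+1%:R^-1 <= harmonic_sum k.+1.
    by rewrite hS [leRHS]big_ord_recr /= lerDl invr_ge0.
  rewrite big_split /= in h1.
  have := tail_prob_le1 (d * 0) r (d * k.+1); have := tail_prob_ge0 0 r k.+1; lra.
rewrite ler_norml; apply/andP; split.
  by have := le_trans (ler_wpM2l (ltW d0R) low2) low; lra.
by have := le_trans up (ler_wpM2l (ltW d0R) up2); lra.
Qed.

Lemma mean_len_diff r k : (0 < r)%N ->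
  k.+1%:R * (mean_len r k.+1 - mean_len r k) =
  \sum_(m < k.+1) (tail_prob m r.-1 (k - m) - tail_prob m r (k - m)).
Proof.
move=> r0; have -> : mean_len r k = \sum_(m < k.+1) tail_prob m r k.
  by rewrite big_ord_recr /= tail_prob_eq0 ?addr0.
rewrite -sumrB mulr_sumr; apply: eq_bigr => m _.
by rewrite tail_prob_diff -ltnS ltn_ord.
Qed.

End TailProb.

(** * Reduction to permutations and to the number of cyclic points *)

Section Expectations.
Variable R : realType.
Implicit Types (n r m : nat).

Lemma card_parking_gt0 n : (0 < #|parking_functions n|)%N.
Proof.
by have := expn_gt0 n.+1 n; rewrite -card_parking_functions muln_gt0 => /andP[].
Qed.

Lemma card_dicycles_above_sum n r m :
  \sum_(f in parking_functions n) (r <= num_above m (dicycles f))%N%:R =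
  \sum_(f in parking_functions n) tail_prob R m r #|cyclic_points f| :> R.
Proof.
rewrite (partition_big (fun f => cyclic_points f) xpredT) //=.
rewrite [RHS](partition_big (fun f => cyclic_points f) xpredT) //=.
apply: eq_bigr => S _.
rewrite [RHS](eq_bigr (fun=> tail_prob R m r #|S|)); last by move=> f /andP[_ /eqP ->].
have k0 : ((#|S|)`!%:R != 0 :> R) by rewrite pnatr_eq0 -lt0n fact_gt0.
have := card_dicycles_above m r S => /(congr1 (fun x => x%:R : R)); rewrite !natrM => e.
transitivity (#|[set f in parking_functions n | cyclic_points f == S]|%:R *
  tail_prob R m r #|S|); last first.
  by rewrite -sum1dep_card natr_sum mulr_suml; apply: eq_bigr => f _; rewrite mul1r.
rewrite /tail_prob mulrA -e.
rewrite mulfK // -sum1dep_card natr_sum [LHS]big_mkcond [RHS]big_mkcond.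
apply: eq_bigr => f _; rewrite andbA.
by case: (_ && (_ == S)); case: (r <= _)%N.
Qed.

Lemma expected_longest_dicycle n r : (0 < r)%N ->
  uniform_expectation (parking_functions n) (fun f => (longest_dicycle r f)%:R : R) =
  uniform_expectation (parking_functions n) (fun f => mean_len R r #|cyclic_points f|).
Proof.
move=> r0; congr (_ / _).
transitivity (\sum_(f in parking_functions n) \sum_(m < n)
   (r <= num_above m (dicycles f))%N%:R : R).
  by apply: eq_bigr => f _; rewrite longest_dicycleE // natr_sum.
rewrite exchange_big /=.
rewrite (eq_bigr (fun m : 'I_n => \sum_(f in parking_functions n) tail_prob R m r #|cyclic_points f|)).
  rewrite exchange_big /=; apply: eq_bigr => f _.
  have kn : (#|cyclic_points f| <= n)%N by rewrite -[X in (_ <= X)%N]card_ord max_card.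
  rewrite /mean_len; move: #|cyclic_points f| kn => k kn.
  rewrite -(subnKC kn) big_split_ord /= [X in _ + X]big1 ?addr0 // => i _.
  by rewrite tail_prob_eq0 // leq_addr.
by move=> m _; apply: card_dicycles_above_sum.
Qed.

Lemma expected_cyclic_points n :
  uniform_expectation (parking_functions n) (fun f => #|cyclic_points f|%:R : R) =
  \sum_(l < n) (n.+1 ^_ l.+1)%:R / (n.+1 ^ l.+1)%:R.
Proof.
rewrite /uniform_expectation -natr_sum sum_card_cyclic_points natr_sum mulr_suml.
apply: eq_bigr => l _.
have := prob_parking_inj_on [set i : 'I_n | (i <= l)%N]; rewrite card_initial.
move=> /(congr1 (fun x => x%:R : R)); rewrite !natrM => e.
apply/eqP; rewrite eqr_div ?e 1?mulrC // pnatr_eq0 -lt0n ?card_parking_gt0 //.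
Qed.

End Expectations.

(** * Power series on the unit disc *)

Section PowerSeries.
Local Open Scope classical_set_scope.
Variable R : realType.
Implicit Types (c : nat -> R) (z M : R).

(** Follows from (k + 1) q^k <= sum_(i <= k) q^i <= 1 / (1 - q), squared.  The leftover
    factor q^(2k) makes the series converge. *)
Lemma sqr_exp_bound (q : R) k : 0 <= q -> q < 1 ->
  k.+2%:R ^+ 2 * (q ^+ 4) ^+ k <= (2 / (1 - q)) ^+ 2 * (q ^+ 2) ^+ k.
Proof.
move=> q0 q1.
have h : k.+2%:R * q ^+ k <= 2 / (1 - q).
  rewrite ler_pdivlMr ?subr_gt0 //.
  have e : 1 - q ^+ k.+1 = (1 - q) * \sum_(i < k.+1) q ^+ i.
    by rewrite -opprB subrX1 -mulNr opprB.
  have e2 : k.+1%:R * q ^+ k <= \sum_(i < k.+1) q ^+ i.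
    rewrite mulr_natl -[X in _ *+ X]card_ord -sumr_const; apply: ler_sum => i _.
    by apply: ler_wiXn2l => //; [exact: ltW|rewrite -ltnS].
  have qk : 0 <= q ^+ k by rewrite exprn_ge0.
  have h1 : k.+2%:R * q ^+ k <= 2 * (k.+1%:R * q ^+ k).
    by rewrite mulrA ler_wpM2r // -natrM ler_nat; lia.
  have h2 : (1 - q) * (k.+1%:R * q ^+ k) <= 1.
    apply: le_trans (_ : (1 - q) * \sum_(i < k.+1) q ^+ i <= _).
      by rewrite ler_wpM2l // subr_ge0 ltW.
    by rewrite -e gerBl exprn_ge0.
  apply: le_trans (ler_wpM2r _ h1) _; first by rewrite subr_ge0 ltW.
  by rewrite -mulrA ler_piMr // mulrC.
rewrite -!exprM (_ : q ^+ (4 * k) = (q ^+ k) ^+ 2 * q ^+ (2 * k)); last first.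
  by rewrite -exprM -exprD; congr (_ ^+ _); lia.
rewrite mulrA -exprMn ler_wpM2r ?exprn_ge0 //.
by rewrite lerXn2r // nnegrE ?mulr_ge0 ?exprn_ge0 ?invr_ge0 // subr_ge0 ltW.
Qed.

Lemma is_cvg_pseries_sqr c z M : (forall k, `|c k| <= M * k.+2%:R ^+ 2) ->
  `|z| < 1 -> cvgn (pseries c z).
Proof.
move=> cM z1; have M0 : 0 <= M.
  have := le_trans (normr_ge0 _) (cM 0%N); rewrite pmulr_lge0 // exprn_gt0 ?ltr0n //.
(* The fourth root leaves room for the polynomial factor. *)
pose q := Num.sqrt (Num.sqrt `|z|).
have q0 : 0 <= q by rewrite sqrtr_ge0.
have qz : q ^+ 4 = `|z|.
  by rewrite (exprM _ 2 2) sqr_sqrtr ?sqrtr_ge0 // sqr_sqrtr.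
have q1 : q < 1.
  by rewrite ltNge; apply/negP => h; move: z1; rewrite -qz ltNge exprn_ege1.
apply: normed_cvg; rewrite /normed_series_of.
apply: (@series_le_cvg _ _ (geometric (M * (2 / (1 - q)) ^+ 2) (q ^+ 2))).
- by move=> n /=; rewrite normr_ge0.
- by move=> n /=; rewrite !mulr_ge0 ?exprn_ge0 ?mulr_ge0 ?invr_ge0 ?subr_ge0 // ltW.
- move=> n /=; rewrite normrM normrX -qz -mulrA.
  apply: le_trans (ler_wpM2l M0 (sqr_exp_bound n q0 q1)).
  by rewrite mulrA ler_wpM2r ?exprn_ge0.
- by apply: is_cvg_geometric_series; rewrite ger0_norm ?exprn_ge0 // exprn_ilt1.
Qed.

Lemma is_cvg_pseries_bounded c z M : (forall k, `|c k| <= M) ->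
  `|z| < 1 -> cvgn (pseries c z).
Proof.
move=> cM; apply: (@is_cvg_pseries_sqr _ _ M) => k; apply: le_trans (cM k) _.
have M0 : 0 <= M := le_trans (normr_ge0 _) (cM 0%N).
by rewrite ler_peMr // exprn_ege1 // ler1n.
Qed.

Lemma is_derive_pseries c z M : (forall k, `|c k| <= M) -> `|z| < 1 ->
  is_derive z (1 : R) (fun x => limn (pseries c x)) (limn (pseries (pseries_diffs c) z)).
Proof.
move=> cM z1; have M0 : 0 <= M := le_trans (normr_ge0 _) (cM 0%N).
(* Any radius strictly between |z| and 1 would do. *)
pose K : R := (1 + `|z|) / 2.
have [zK K1] : `|z| < `|K| /\ `|K| < 1.
  have K0 : 0 <= K by rewrite /K divr_ge0 ?addr_ge0.
  by rewrite (ger0_norm K0) /K; move: z1; move: (`|z|) => a a1; split; lra.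
apply: (@pseries_snd_diffs _ c K z) zK.
- exact: is_cvg_pseries_bounded cM K1.
- apply: (@is_cvg_pseries_sqr _ _ M) K1 => k; rewrite /pseries_diffs normrM normr_nat mulrC.
  rewrite ler_pM // -natrX ler_nat; nia.
- apply: (@is_cvg_pseries_sqr _ _ M) K1 => k; rewrite /pseries_diffs !normrM !normr_nat.
  by rewrite mulrA mulrC ler_pM // -natrM -natrX ler_nat; nia.
Qed.

(** Summation by parts: passing to partial sums divides a power series by 1 - z. *)
Lemma pseries_partial_sums c z : cvgn (pseries (fun k => \sum_(j < k.+1) c j) z) ->
  pseries c z @ \oo --> (1 - z) * limn (pseries (fun k => \sum_(j < k.+1) c j) z).
Proof.
move=> cvC; set C := fun k => _ in cvC *.
have E : pseries c z = (fun n => (1 - z) * pseries C z n + \sum_(j < n) c j * z ^+ n).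
  apply/funext => n; rewrite /pseries /series /= !big_mkord.
  elim: n => [|n IH]; first by rewrite !big_ord0 mulr0 addr0.
  rewrite !big_ord_recr /= IH /C !big_ord_recr /= -!mulr_suml exprS; ring.
have C0 : (fun n => \sum_(j < n) c j * z ^+ n) @ \oo --> 0.
  rewrite -cvg_shiftS /=.
  have -> : (fun n => \sum_(j < n.+1) c j * z ^+ n.+1) = (fun n => z * (C n * z ^+ n)).
    by apply/funext => n; rewrite /C -mulr_suml exprS; ring.
  by have := cvgM (cvg_cst z) (cvg_series_cvg_0 cvC); rewrite mulr0; apply.
by rewrite E; have := cvgD (cvgM (cvg_cst (1 - z)) cvC) C0; rewrite addr0; apply.
Qed.

Lemma pseries_shift c z m M : (forall k, `|c k| <= M) -> `|z| < 1 ->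
  limn (pseries (fun k => if (m <= k)%N then c (k - m)%N else 0) z) =
  z ^+ m * limn (pseries c z).
Proof.
move=> cM z1; apply/cvg_lim => //.
rewrite -(cvg_shiftn m) /=.
have -> : (fun n => pseries (fun k => if (m <= k)%N then c (k - m)%N else 0) z (n + m)%N) =
          (fun n => z ^+ m * pseries c z n).
  apply/funext => n; rewrite /pseries /series /= !big_mkord addnC big_split_ord /=.
  rewrite big1 ?add0r; last by move=> i _; rewrite leqNgt ltn_ord mul0r.
  rewrite mulr_sumr; apply: eq_bigr => i _.
  by rewrite leq_addr addKn exprD mulrCA.
apply: cvgM; first exact: cvg_cst.
exact: is_cvg_pseries_bounded cM z1.
Qed.

End PowerSeries.

(** * The Shepp-Lloyd formula *)

Section GeneratingFunction.
Local Open Scope classical_set_scope.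
Variable R : realType.
Implicit Types (z x : R) (m i k : nat).

Lemma lim_pseries0 (c : nat -> R) : limn (pseries c 0) = c 0%N.
Proof.
apply/cvg_lim => //; rewrite -cvg_shiftS /=.
have -> : (fun n => pseries c 0 n.+1) = (fun=> c 0%N).
  apply/funext => n; rewrite /pseries /series /= big_mkord big_ord_recl big1 ?addr0 ?expr0 ?mulr1 //.
  by move=> j _; rewrite expr0n /= mulr0.
exact: cvg_cst.
Qed.

Lemma lim_pseries1 z : `|z| < 1 -> limn (pseries (fun=> 1) z) = (1 - z)^-1.
Proof.
move=> z1; apply/cvg_lim => //.
by have := @cvg_geometric_series _ 1 _ z1; rewrite mul1r.
Qed.

Definition exact_prob m i k : R := tail_prob R m i k - tail_prob R m i.+1 k.

Lemma exact_prob_bounds m i k : 0 <= exact_prob m i k <= 1.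
Proof.
rewrite /exact_prob subr_ge0 tail_prob_le /=.
by have := tail_prob_le1 R m i k; have := tail_prob_ge0 R m i.+1 k; lra.
Qed.

Lemma norm_exact_prob m i k : `|exact_prob m i k| <= 1.
Proof. by have /andP[h1 h2] := exact_prob_bounds m i k; rewrite ger0_norm. Qed.

(** Read on generating functions, with F_i that of [exact_prob m i], this says
    ((1 - z) F_i)' = z^m (F_(i-1) - F_i), where F_(-1) = 0. *)
Lemma exact_prob_diff m i k :
  k.+1%:R * (exact_prob m i k.+1 - exact_prob m i k) =
  if (m <= k)%N then (if i is i'.+1 then exact_prob m i' (k - m) else 0) - exact_prob m i (k - m) else 0.
Proof.
have h1 := tail_prob_diff R m i k; have h2 := tail_prob_diff R m i.+1 k.
rewrite /exact_prob.
have -> : k.+1%:R * (tail_prob R m i k.+1 - tail_prob R m i.+1 k.+1 - (tail_prob R m i k - tail_prob R m i.+1 k)) =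
  k.+1%:R * (tail_prob R m i k.+1 - tail_prob R m i k) - k.+1%:R * (tail_prob R m i.+1 k.+1 - tail_prob R m i.+1 k) by ring.
rewrite h1 h2; case: ifP => // _; last by rewrite subr0.
by case: i {h1 h2} => [|i] /=; ring.
Qed.

Lemma exact_prob0 m i : exact_prob m i 0 = (i == 0%N)%:R.
Proof.
rewrite /exact_prob (@tail_prob_eq0 _ m i.+1) //.
by case: i => [|i]; rewrite ?tail_prob0 ?tail_prob_eq0 // subr0.
Qed.

(** The tail of the series of - ln (1 - z). *)
Definition log_tail m z : R := limn (pseries (fun k => if (m < k)%N then k%:R^-1 else 0) z).

Definition poisson i x : R := x ^+ i / i`!%:R * expR (- x).

Lemma is_derive_log_tail m z : `|z| < 1 -> is_derive z (1 : R) (log_tail m) (z ^+ m / (1 - z)).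
Proof.
move=> z1; rewrite -(lim_pseries1 z1) -(@pseries_shift _ _ _ m 1) //; last by move=> k; rewrite normr1.
have -> : (fun k => if (m <= k)%N then 1 else 0 : R) =
   pseries_diffs (fun k => if (m < k)%N then k%:R^-1 else 0).
  by apply/funext => k; rewrite /pseries_diffs ltnS; case: ifP; rewrite ?mulr0 // mulfV.
apply: (@is_derive_pseries _ _ _ 1) => // k; case: ifP => mk; last by rewrite normr0.
by rewrite ger0_norm ?invr_ge0 // invf_le1 ?ler1n ?ltr0n // (leq_ltn_trans _ mk).
Qed.

Definition exact_gf m i z : R := limn (pseries (exact_prob m i) z).

(** (1 - z) F is the power series whose coefficients are the increments of those of F,
    which stay bounded, so it may be differentiated termwise. *)
Lemma is_derive_exact_gf m i z : `|z| < 1 ->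
  is_derive z (1 : R) (fun x => (1 - x) * exact_gf m i x)
   (z ^+ m * ((if i is i'.+1 then exact_gf m i' z else 0) - exact_gf m i z)).
Proof.
move=> z1.
pose phi k := if k is k'.+1 then exact_prob m i k - exact_prob m i k' else exact_prob m i 0.
have phi1 k : `|phi k| <= 1.
  case: k => [|k] /=; first exact: norm_exact_prob.
  have /andP[h1 h2] := exact_prob_bounds m i k.+1; have /andP[h3 h4] := exact_prob_bounds m i k.
  by rewrite ler_norml; lra.
have sphi : (fun k => \sum_(j < k.+1) phi j) = exact_prob m i.
  apply/funext; elim => [|k IH]; first by rewrite big_ord_recl big_ord0 addr0.
  by rewrite big_ord_recr /= IH addrC subrK.
have phiE x : `|x| < 1 -> limn (pseries phi x) = (1 - x) * exact_gf m i x.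
  move=> x1; apply/cvg_lim => //; rewrite /exact_gf -sphi; apply: pseries_partial_sums.
  by rewrite sphi; apply: (@is_cvg_pseries_bounded _ _ _ 1 _ x1); apply: norm_exact_prob.
have := is_derive_pseries phi1 z1.
have -> : limn (pseries (pseries_diffs phi) z) =
  z ^+ m * ((if i is i'.+1 then exact_gf m i' z else 0) - exact_gf m i z).
  pose psi k := (if i is i'.+1 then exact_prob m i' k else 0) - exact_prob m i k.
  have -> : pseries_diffs phi = (fun k => if (m <= k)%N then psi (k - m)%N else 0).
    by apply/funext => k; rewrite /pseries_diffs /phi /= exact_prob_diff.
  have cg j : cvgn (pseries (exact_prob m j) z).
    by apply: (@is_cvg_pseries_bounded _ _ _ 1) => // k; apply: norm_exact_prob.
  rewrite (@pseries_shift _ _ _ _ 1) //; last first.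
    move=> k; rewrite /psi; have := exact_prob_bounds m i k; case: (i) => [|i'].
      by move=> /andP[h1 h2]; rewrite sub0r normrN ger0_norm.
    have := exact_prob_bounds m i' k => /andP[h1 h2] /andP[h3 h4].
    by rewrite ler_norml; lra.
  congr (_ * _); rewrite /psi /exact_gf; case: (i) => [|i'].
    apply/cvg_lim => //; rewrite sub0r.
    have -> : pseries (fun k => 0 - exact_prob m 0 k) z = - pseries (exact_prob m 0) z.
      apply/funext => n; rewrite !fctE /pseries /series /= -sumrN.
      by apply: eq_bigr => j _; rewrite sub0r mulNr.
    by apply: cvgN; apply: cg.
  apply/cvg_lim => //.
  have -> : pseries (fun k => exact_prob m i' k - exact_prob m i'.+1 k) z =
     pseries (exact_prob m i') z - pseries (exact_prob m i'.+1) z.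
    apply/funext => n; rewrite !fctE /pseries /series /= -sumrB.
    by apply: eq_bigr => j _; rewrite mulrBl.
  by apply: cvgB; apply: cg.
move=> d; apply: near_eq_is_derive d.
have zin : z \in `](-1), 1[%R by rewrite in_itv /= -ltr_norml.
apply: filterS (near_in_itvoo zin) => x.
by rewrite in_itv /= -ltr_norml => /phiE.
Qed.

(** Both sides solve the same differential equation in z with the same value at 0:
    by induction on i, the derivative of
    (1 - z) F_i(z) e^lambda - lambda^i / i!, lambda = lambda_m(z), vanishes. *)
Lemma exact_gf_poisson m i z : 0 <= z -> z < 1 ->
  (1 - z) * exact_gf m i z = poisson i (log_tail m z).
Proof.
(* The index i - 1 is encoded by a case distinction, all terms being 0 at i = 0. *)
pose prev j x := if j is j'.+1 then exact_gf m j' x else 0.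
pose dpow j x : R := if j is j'.+1 then x ^+ j' / j'`!%:R else 0.
suff main j : (forall x, 0 <= x -> x < 1 -> (1 - x) * prev j x = dpow j (log_tail m x) * expR (- log_tail m x)) ->
    forall x, 0 <= x -> x < 1 -> (1 - x) * exact_gf m j x = poisson j (log_tail m x).
  by elim: i z => [|i IH]; apply: main => x x0 x1; [rewrite mulr0 mul0r|exact: IH].
move=> {z i} H z z0 z1.
pose D : R -> R := (fun x => (1 - x) * exact_gf m j x) * (expR \o log_tail m) - (j`!%:R^-1 \*: (log_tail m ^+ j)).
have dD x : 0 <= x -> x < 1 -> is_derive x (1 : R) D 0.
  move=> x0 x1; have nx : `|x| < 1 by rewrite ger0_norm.
  have d1 := is_derive_exact_gf m j nx; have d2 := is_derive_log_tail m nx.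
  have d3 := is_derive1_comp (is_derive_expR (log_tail m x)) d2.
  have d4 := is_deriveZ (j`!%:R^-1) (is_deriveX j d2).
  apply: is_derive_eq (is_deriveB (is_deriveM d1 d3) d4) _.
  have x1' : 1 - x != 0 by rewrite subr_eq0 gt_eqF.
  have -> : j`!%:R^-1 *: ((j%:R * log_tail m x ^+ j.-1) *: (x ^+ m / (1 - x))) =
            dpow j (log_tail m x) * (x ^+ m / (1 - x)) :> R.
    rewrite /dpow; case: (j) => [|k]; first by rewrite !mul0r scale0r scaler0.
    rewrite /= factS natrM.
    have h : (k`!%:R != 0 :> R) by rewrite pnatr_eq0 -lt0n fact_gt0.
    by rewrite /GRing.scale /=; field; rewrite x1' h nat1r pnatr_eq0.
  have -> : dpow j (log_tail m x) = (1 - x) * prev j x * expR (log_tail m x).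
    by rewrite H // -mulrA -expRD addNr expR0 mulr1.
  rewrite -/(prev j x) /GRing.scale /=; move: (prev j x) (exact_gf m j x) => P F.
  by field.
have D0 : D 0 = 0.
  rewrite /D !fctE /= /GRing.scale /= /exact_gf /log_tail !lim_pseries0 ltn0 exact_prob0 expR0 subr0 !mulr1 mul1r.
  by case: (j) => [|k]; rewrite ?expr0n /= ?fact0 ?invr1 ?mulr1 ?mulr0 subrr.
have [||c _] := @MVT_segment R D (fun=> 0) 0 z z0.
- by move=> x; rewrite in_itv /= => /andP[/ltW h1 /lt_trans/(_ z1) h2]; apply: dD.
- apply: derivable_within_continuous => x; rewrite in_itv /= => /andP[h1 /le_lt_trans/(_ z1) h2].
  by have [] := dD x h1 h2.
rewrite mul0r D0 subr0 => /eqP; rewrite /D !fctE /= subr_eq0 => /eqP e.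
have -> : poisson j (log_tail m z) = (1 - z) * exact_gf m j z * expR (log_tail m z) * expR (- log_tail m z).
  by rewrite e /poisson /GRing.scale /= [_^-1 * _]mulrC.
by rewrite -mulrA -expRD subrr expR0 mulr1.
Qed.

End GeneratingFunction.

(** * Linear growth of the mean length, and Abel summation *)

Section MeanLen.
Local Open Scope classical_set_scope.
Variable R : realType.
Implicit Types (z x : R) (m i k : nat).

(** A null sequence is at most e plus a finitely supported error; this form can be
    summed against any weights. *)
Lemma inv_succ_le (e : R) : 0 < e -> exists M : nat, forall m, m.+1%:R^-1 <= e + (m < M)%N%:R.
Proof.
move=> e0; exists (Num.truncn e^-1) => m; have [mM|Mm] := ltnP.
  have : (m.+1%:R : R)^-1 <= 1 by rewrite invf_le1 ?ler1n ?ltr0n.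
  by move: (m.+1%:R^-1 : R) => y; rewrite /=; lra.
rewrite addr0 -[leRHS]invrK lef_pV2 ?posrE ?ltr0n ?invr_gt0 //.
apply: ltW; apply: lt_le_trans (truncnS_gt _) _.
by rewrite ler_nat ltnS.
Qed.

Lemma sum_ltn_le (n M : nat) : (\sum_(0 <= m < n) (m < M) <= M)%N.
Proof.
have h k : (\sum_(0 <= m < k) (m < M) = minn k M)%N.
  elim: k => [|k IH]; first by rewrite big_geq // min0n.
  by rewrite big_nat_recr //= IH; case: ltnP => h /=; lia.
by rewrite h geq_minr.
Qed.

Lemma harmonic_sum_le (e : R) : 0 < e ->
  exists C : R, forall k, harmonic_sum R k <= e * k%:R + C.
Proof.
move=> /inv_succ_le[M h]; exists M%:R => k.
apply: le_trans (ler_sum _ (fun (m : 'I_k) _ => h m)) _.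
rewrite big_split /= sumr_const card_ord mulr_natr lerD2l -natr_sum ler_nat.
rewrite -(big_mkord xpredT (fun m => nat_of_bool (m < M)))%N.
exact: sum_ltn_le.
Qed.

(** Equivalent to a k / k --> c; the additive constant spares a case distinction on
    small k and survives averaging over k. *)
Definition linear_growth (a : nat -> R) (c : R) :=
  forall e : R, 0 < e -> exists C : R, forall k, `|a k - c * k%:R| <= e * k%:R + C.

(** With b(k) = a(k) / k and eps(k) = (1 + H_k) / k, comparing both b(k) and b(l) with
    b(k l) gives |b(k) - b(l)| <= eps(k) + eps(l).  So every b(k) - eps(k) is at most
    every b(l) + eps(l), and the supremum c of the former satisfies
    |b(k) - c| <= eps(k). *)
Lemma mean_len_linear r : (0 < r)%N -> exists c, linear_growth (mean_len R r) c.
Proof.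
move=> r0; pose a k := mean_len R r k; pose e k := 1 + harmonic_sum R k.
have cross k l : (0 < k)%N -> (0 < l)%N ->
    (a k - e k) / k%:R <= (a l + e l) / l%:R.
  move=> k0 l0; have k0R : (0 : R) < k%:R by rewrite ltr0n.
  have l0R : (0 : R) < l%:R by rewrite ltr0n.
  have := mean_len_scale R k r0 l0; rewrite ler_norml => /andP[h1 _].
  have := mean_len_scale R l r0 k0; rewrite ler_norml mulnC => /andP[_ h2].
  rewrite ler_pdivrMr // mulrAC ler_pdivlMr // /a /e.
  rewrite [_ * l%:R]mulrC [_ * k%:R]mulrC mulrBr mulrDr; lra.
pose A := [set y | exists2 k, (0 < k)%N & y = (a k - e k) / k%:R].
have ubA k : (0 < k)%N -> ubound A ((a k + e k) / k%:R).
  by move=> k0 _ [l l0 ->]; apply: cross.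
have supA : has_sup A.
  by split; [exists ((a 1%N - e 1%N) / 1%:R); exists 1%N|exists ((a 1%N + e 1%N) / 1%:R); apply: ubA].
exists (sup A).
have bound k : `|a k - sup A * k%:R| <= e k.
  case: k => [|k].
    by rewrite mulr0 subr0 /a /mean_len big_ord0 normr0 /e /harmonic_sum big_ord0 addr0.
  have k0R : (0 : R) < k.+1%:R by rewrite ltr0n.
  have h1 : sup A <= (a k.+1 + e k.+1) / k.+1%:R by apply: ge_sup; [exact: supA.1|exact: ubA].
  have h2 : (a k.+1 - e k.+1) / k.+1%:R <= sup A by apply: ub_le_sup; [exact: supA.2|exists k.+1].
  move: h1 h2; rewrite ler_pdivlMr // ler_pdivrMr // ler_distl; lra.
move=> eps /harmonic_sum_le[C hC]; exists (1 + C) => k.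
by apply: le_trans (bound k) _; rewrite /e; have := hC k; lra.
Qed.

Lemma le_norm_lim_pseries (s t : nat -> R) z : 0 <= z ->
  cvgn (pseries s z) -> cvgn (pseries t z) -> (forall k, `|s k| <= t k) ->
  `|limn (pseries s z)| <= limn (pseries t z).
Proof.
move=> z0 cs ct st.
have h : cvgn [normed series (fun k => s k * z ^+ k)].
  apply: (@series_le_cvg _ _ (fun k => t k * z ^+ k)) => // k.
  - exact: normr_ge0.
  - by rewrite mulr_ge0 ?exprn_ge0 //; apply: le_trans (st k).
  - by rewrite /= normrM (ger0_norm (exprn_ge0 _ z0)) ler_wpM2r ?exprn_ge0.
apply: le_trans (lim_series_norm h) _.
apply: (lim_series_le h ct) => k /=.
by rewrite normrM (ger0_norm (exprn_ge0 _ z0)) ler_wpM2r ?exprn_ge0.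
Qed.

Lemma lim_pseriesD (s t : nat -> R) z : cvgn (pseries s z) -> cvgn (pseries t z) ->
  pseries (fun k => s k + t k) z @ \oo --> limn (pseries s z) + limn (pseries t z).
Proof.
move=> cs ct.
have -> : pseries (fun k => s k + t k) z = (fun n => pseries s z n + pseries t z n).
  by apply/funext => n; rewrite /pseries /series /= -big_split; apply: eq_bigr => j _; rewrite mulrDl.
exact: cvgD.
Qed.

Lemma lim_pseriesZ (s : nat -> R) (l : R) z : cvgn (pseries s z) ->
  pseries (fun k => l * s k) z @ \oo --> l * limn (pseries s z).
Proof.
move=> cs.
have -> : pseries (fun k => l * s k) z = (fun n => l * pseries s z n).
  by apply/funext => n; rewrite /pseries /series /= mulr_sumr; apply: eq_bigr => j _; rewrite mulrA.
exact: cvgM (cvg_cst _) cs.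
Qed.

Lemma lim_pseries_succ z : 0 <= z -> z < 1 ->
  pseries (fun k => k.+1%:R) z @ \oo --> (1 - z) ^- 2.
Proof.
move=> z0 z1; have nz : `|z| < 1 by rewrite ger0_norm.
have e : (fun k => k.+1%:R) = (fun k => \sum_(j < k.+1) 1) :> (nat -> R).
  by apply/funext => k; rewrite sumr_const card_ord.
have cv : cvgn (pseries (fun k => k.+1%:R : R) z).
  apply: (@is_cvg_pseries_sqr _ _ _ 1 _ nz) => k.
  by rewrite normr_nat mul1r -natrX ler_nat; nia.
have := @pseries_partial_sums R (fun=> 1) z; rewrite -e => /(_ cv) /cvg_lim.
rewrite lim_pseries1 // => /(_ _) h.
suff <- : limn (pseries (fun k => k.+1%:R : R) z) = (1 - z) ^- 2 by exact: cv.
have z1' : 1 - z != 0 by rewrite subr_eq0 gt_eqF.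
apply: (mulfI z1'); rewrite -h //.
by field.
Qed.

(** The coefficients of (1 - z)^(-3). *)
Definition triangular k : R := k.+1%:R * k.+2%:R / 2.

Lemma lim_pseries_triangular z : 0 <= z -> z < 1 -> pseries triangular z @ \oo --> (1 - z) ^- 3.
Proof.
move=> z0 z1; have nz : `|z| < 1 by rewrite ger0_norm.
have e : triangular = (fun k => \sum_(j < k.+1) j.+1%:R) :> (nat -> R).
  apply/funext; elim => [|k IH]; first by rewrite big_ord1 /triangular /=; field.
  by rewrite big_ord_recr /= -IH /triangular -!natr1; field.
have cv : cvgn (pseries triangular z).
  apply: (@is_cvg_pseries_sqr _ _ _ 1 _ nz) => k.
  rewrite ger0_norm /triangular ?divr_ge0 ?mulr_ge0 // mul1r ler_pdivrMr // -natrM -natrX -natrM ler_nat; nia.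
have := @pseries_partial_sums R (fun k => k.+1%:R) z; rewrite -e => /(_ cv) /cvg_lim h.
have {}h := h (@Rhausdorff R); rewrite (cvg_lim _ (lim_pseries_succ z0 z1)) // in h.
suff <- : limn (pseries triangular z) = (1 - z) ^- 3 by exact: cv.
have z1' : 1 - z != 0 by rewrite subr_eq0 gt_eqF.
by apply: (mulfI z1'); rewrite -h; field.
Qed.

(** On generating functions this is a |-> ((1 - z) A(z))'. *)
Definition scaled_diff (a : nat -> R) k : R := k.+1%:R * (a k.+1 - a k).

(** For a linear sequence a k = c * k the partial sums of [scaled_diff a] are exactly
    c times the triangular numbers; the error is controlled by summation by
    parts. *)
Lemma sum_scaled_diff a c e C k : a 0%N = 0 -> 0 <= e ->
  (forall k, `|a k - c * k%:R| <= e * k%:R + C) ->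
  `|\sum_(j < k.+1) scaled_diff a j - c * triangular k| <= 4 * e * triangular k + 2 * C * k.+1%:R.
Proof.
move=> a0 e0 h; pose b j := a j - c * j%:R.
have E : \sum_(j < k.+1) scaled_diff a j - c * triangular k = k.+1%:R * b k.+1 - \sum_(j < k.+1) b j.
  elim: (k) => [|n IH].
    by rewrite !big_ord_recl !big_ord0 /scaled_diff /b /triangular a0 /=; lra.
  rewrite big_ord_recr /= [in RHS]big_ord_recr /= opprD addrA.
  have -> : \sum_(j < n.+1) b j = n.+1%:R * b n.+1 - (\sum_(j < n.+1) scaled_diff a j - c * triangular n).
    by rewrite IH; ring.
  by rewrite /scaled_diff /b /triangular -!natr1; field.
rewrite {}E; apply: le_trans (ler_normB _ _) _.
have C0 : 0 <= C by have := le_trans (normr_ge0 _) (h 0%N); rewrite mulr0 add0r.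
have s1 : `|\sum_(j < k.+1) b j| <= k.+1%:R * (e * k.+1%:R + C).
  apply: le_trans (ler_norm_sum _ _ _) _.
  rewrite mulr_natl -[X in _ *+ X]card_ord -sumr_const; apply: ler_sum => j _.
  apply: le_trans (h j) _; rewrite lerD2r ler_wpM2l // ler_nat; exact: ltnW.
have s2 : `|k.+1%:R * b k.+1| <= k.+1%:R * (e * k.+1%:R + C).
  by rewrite normrM normr_nat ler_wpM2l //; apply: h.
apply: le_trans (lerD s2 s1) _.
rewrite -subr_ge0 (_ : _ - _ = 2 * e * k.+1%:R); first by rewrite !mulr_ge0.
by rewrite /triangular -!natr1; field.
Qed.

(** Two summations by parts, then comparison with (1 - z)^(-3) and (1 - z)^(-2). *)
Lemma abel_scaled_diff a c : a 0%N = 0 -> linear_growth a c ->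
  (forall k, `|scaled_diff a k| <= k.+1%:R) ->
  forall e : R, 0 < e -> exists C : R, forall z, 0 <= z -> z < 1 ->
  `|(1 - z) ^+ 2 * limn (pseries (scaled_diff a) z) - c| <= e + C * (1 - z).
Proof.
move=> a0 lg ub e e0; have e4 : 0 < e / 4 by rewrite divr_gt0.
have [C hC] := lg _ e4; exists (2 * C) => z z0 z1.
have nz : `|z| < 1 by rewrite ger0_norm.
have z1p : 0 < 1 - z by rewrite subr_gt0.
pose S k := \sum_(j < k.+1) scaled_diff a j.
have Sub k : `|S k| <= 1 * k.+2%:R ^+ 2.
  apply: le_trans (ler_norm_sum _ _ _) _.
  apply: le_trans (_ : \sum_(j < k.+1) k.+1%:R <= _).
    by apply: ler_sum => j _; apply: le_trans (ub j) _; rewrite ler_nat.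
  rewrite sumr_const card_ord -mulrnA mul1r -natrX ler_nat; nia.
have cS : cvgn (pseries S z) by apply: is_cvg_pseries_sqr Sub nz.
have ctri : cvgn (pseries triangular z) by apply: cvgP (lim_pseries_triangular z0 z1).
have csucc : cvgn (pseries (fun k => k.+1%:R : R) z) by apply: cvgP (lim_pseries_succ z0 z1).
have ltri : limn (pseries triangular z) = (1 - z) ^- 3 by apply/cvg_lim => //; apply: lim_pseries_triangular.
have lsucc : limn (pseries (fun k => k.+1%:R : R) z) = (1 - z) ^- 2 by apply/cvg_lim => //; apply: lim_pseries_succ.
have lZ l s : cvgn (pseries s z) -> limn (pseries (fun k => l * s k) z) = l * limn (pseries s z).
  by move=> cs; apply/cvg_lim => //; apply: lim_pseriesZ.
have lD := lim_pseriesD cS (cvgP _ (@lim_pseriesZ _ (- c) _ ctri)).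
have lT := lim_pseriesD (cvgP _ (@lim_pseriesZ _ e _ ctri)) (cvgP _ (@lim_pseriesZ _ (2 * C) _ csucc)).
have := @le_norm_lim_pseries _ _ z z0 (cvgP _ lD) (cvgP _ lT) _.
rewrite (cvg_lim _ lD) // (cvg_lim _ lT) // !lZ //.
rewrite ltri lsucc (cvg_lim _ (pseries_partial_sums cS)) //= -/S => h.
have {}h : `|limn (pseries S z) + - c * (1 - z) ^- 3| <= e * (1 - z) ^- 3 + 2 * C * (1 - z) ^- 2.
  apply: h => k; rewrite mulNr.
  have := sum_scaled_diff k a0 (ltW e4) hC.
  by rewrite (_ : 4 * (e / 4) = e) //; field.
have z1' : 1 - z != 0 by rewrite gt_eqF.
have z3 : 0 < (1 - z) ^+ 3 by rewrite exprn_gt0.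
rewrite (_ : (1 - z) ^+ 2 * ((1 - z) * limn (pseries S z)) - c =
   (1 - z) ^+ 3 * (limn (pseries S z) + - c * (1 - z) ^- 3)); last by field.
rewrite normrM gtr0_norm // (_ : e + 2 * C * (1 - z) =
   (1 - z) ^+ 3 * (e * (1 - z) ^- 3 + 2 * C * (1 - z) ^- 2)); last by field.
by rewrite ler_pM2l.
Qed.

Lemma sum_triangle (G : nat -> nat -> R) n :
  \sum_(k < n) \sum_(m < k.+1) G m (k - m)%N = \sum_(m < n) \sum_(j < n - m) G m j.
Proof.
elim: n => [|n IH]; first by rewrite !big_ord0.
rewrite big_ord_recr /= IH [RHS]big_ord_recr /= subSnn big_ord1.
rewrite big_ord_recr /= subnn addrA; congr (_ + _).
rewrite -big_split /=; apply: eq_bigr => m _.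
by rewrite subSn ?big_ord_recr //= ltnW.
Qed.

Lemma pseries_tail (c : nat -> R) z q : (forall k, `|c k| <= 1) -> 0 <= z -> z < 1 ->
  `|limn (pseries c z) - \sum_(j < q) c j * z ^+ j| <= z ^+ q / (1 - z).
Proof.
move=> c1 z0 z1; have nz : `|z| < 1 by rewrite ger0_norm.
have cv : cvgn (pseries c z) by apply: is_cvg_pseries_bounded c1 nz.
have h : (fun n => pseries c z n - \sum_(j < q) c j * z ^+ j) @ \oo --> limn (pseries c z) - \sum_(j < q) c j * z ^+ j.
  by apply: cvgB => //; apply: cvg_cst.
have h2 : `|pseries c z n - \sum_(j < q) c j * z ^+ j| @[n --> \oo] -->
    `|limn (pseries c z) - \sum_(j < q) c j * z ^+ j| by exact: cvg_norm h.
rewrite -(cvg_lim (@Rhausdorff R) h2); apply: limr_le; first by apply: cvgP h2.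
exists q => // n /= qn; rewrite /pseries /series /= big_mkord -(subnKC qn) big_split_ord /= addrAC subrr add0r.
apply: le_trans (ler_norm_sum _ _ _) _.
apply: le_trans (_ : \sum_(i < n - q) z ^+ q * z ^+ i <= _).
  apply: ler_sum => i _; rewrite normrM exprD (ger0_norm (_ : 0 <= z ^+ q * z ^+ i)) ?mulr_ge0 ?exprn_ge0 //.
  by rewrite ler_piMl ?mulr_ge0 ?exprn_ge0.
rewrite -mulr_sumr ler_wpM2l ?exprn_ge0 //.
have z1p : 0 < 1 - z by rewrite subr_gt0.
rewrite -[leRHS]mul1r ler_pdivlMr // mulrC.
have -> : (1 - z) * \sum_(i < n - q) z ^+ i = 1 - z ^+ (n - q).
  by rewrite -[RHS]opprB subrX1 -mulNr opprB.
by rewrite gerBl exprn_ge0.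
Qed.

Lemma scaled_diff_mean_len i k :
  scaled_diff (mean_len R i.+1) k = \sum_(m < k.+1) exact_prob R m i (k - m).
Proof. by rewrite /scaled_diff mean_len_diff. Qed.

Lemma poisson_ge0 i x : 0 <= x -> 0 <= poisson i x.
Proof. by move=> x0; rewrite /poisson !mulr_ge0 ?exprn_ge0 ?invr_ge0 ?expR_ge0. Qed.

Lemma scaled_diff_mean_len_bound i k : `|scaled_diff (mean_len R i.+1) k| <= k.+1%:R.
Proof.
rewrite scaled_diff_mean_len; apply: le_trans (ler_norm_sum _ _ _) _.
rewrite -[X in _ <= X%:R]card_ord -[leRHS]mulr1 mulr_natl -sumr_const.
by apply: ler_sum => m _; apply: norm_exact_prob.
Qed.

(** Summing [tail_prob_diff] over m expresses [scaled_diff] of the mean length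
    as a convolution, whose generating function is sum_m z^m F_m(z).  Rearranged
    partial sums differ from those of this series by at most n z^n. *)
Lemma gf_scaled_diff_mean_len i z : 0 <= z -> z < 1 ->
  pseries (fun m => poisson i (log_tail m z)) z @ \oo -->
  (1 - z) * limn (pseries (scaled_diff (mean_len R i.+1)) z).
Proof.
move=> z0 z1; have nz : `|z| < 1 by rewrite ger0_norm.
have z1p : 0 < 1 - z by rewrite subr_gt0.
have cu : cvgn (pseries (scaled_diff (mean_len R i.+1)) z).
  apply: (@is_cvg_pseries_sqr _ _ _ 1 _ nz) => k; apply: le_trans (scaled_diff_mean_len_bound i k) _.
  by rewrite mul1r -natrX ler_nat; nia.
pose err n := pseries (fun m => poisson i (log_tail m z)) z n -
  (1 - z) * pseries (scaled_diff (mean_len R i.+1)) z n.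
have errE n : err n = (1 - z) * \sum_(m < n) z ^+ m *
    (exact_gf m i z - \sum_(j < n - m) exact_prob R m i j * z ^+ j).
  rewrite /err /pseries /series /= !big_mkord.
  have -> : \sum_(k < n) scaled_diff (mean_len R i.+1) k * z ^+ k =
     \sum_(m < n) \sum_(j < n - m) z ^+ m * (exact_prob R m i j * z ^+ j).
    rewrite -(sum_triangle (fun m j => z ^+ m * (exact_prob R m i j * z ^+ j))).
    apply: eq_bigr => k _; rewrite scaled_diff_mean_len mulr_suml; apply: eq_bigr => m _.
    by rewrite mulrCA -exprD subnKC // -ltnS.
  rewrite !mulr_sumr -sumrB; apply: eq_bigr => m _.
  rewrite -exact_gf_poisson // -mulr_sumr; ring.
have err_le n : `|err n| <= n%:R * z ^+ n.
  rewrite errE normrM gtr0_norm // mulrC -ler_pdivlMr //.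
  apply: le_trans (ler_norm_sum _ _ _) _.
  apply: le_trans (_ : \sum_(m < n) z ^+ n / (1 - z) <= _).
    apply: ler_sum => m _; rewrite normrM ger0_norm ?exprn_ge0 //.
    have := @pseries_tail (exact_prob R m i) z (n - m) (norm_exact_prob R m i) z0 z1.
    rewrite -/(exact_gf m i z) => /(ler_wpM2l (exprn_ge0 m z0)) /le_trans; apply.
    by rewrite mulrA -exprD subnKC // ltnW.
  by rewrite sumr_const card_ord -mulrA mulr_natl.
have err0 : err @ \oo --> (0 : R).
  have cn : cvgn (pseries (fun k => k%:R : R) z).
    apply: (@is_cvg_pseries_sqr _ _ _ 1 _ nz) => k.
    by rewrite normr_nat mul1r -natrX ler_nat; nia.
  have h0 : (fun n => n%:R * z ^+ n) @ \oo --> (0 : R) := cvg_series_cvg_0 cn.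
  have h1 : (fun n => - (n%:R * z ^+ n)) @ \oo --> (0 : R).
    by rewrite -oppr0; apply: cvgN h0.
  apply: (squeeze_cvgr _ h1 h0); apply: nearW => n.
  by rewrite -ler_norml.
have -> : pseries (fun m => poisson i (log_tail m z)) z =
    (fun n => (1 - z) * pseries (scaled_diff (mean_len R i.+1)) z n + err n).
  by apply/funext => n; rewrite /err addrC subrK.
by have := cvgD (cvgM (cvg_cst (1 - z)) cu) err0; rewrite addr0; apply.
Qed.

Lemma abel_poisson i c : linear_growth (mean_len R i.+1) c ->
  forall e : R, 0 < e -> exists C : R, forall z, 0 <= z -> z < 1 ->
  `|(1 - z) * limn (pseries (fun m => poisson i (log_tail m z)) z) - c| <= e + C * (1 - z).
Proof.
move=> lg e e0.
have a0 : mean_len R i.+1 0 = 0 by rewrite /mean_len big_ord0.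
have [C hC] := abel_scaled_diff a0 lg (scaled_diff_mean_len_bound i) e0.
exists C => z z0 z1; have := hC z z0 z1; rewrite expr2 -mulrA.
suff -> : limn (pseries (fun m => poisson i (log_tail m z)) z) =
  (1 - z) * limn (pseries (scaled_diff (mean_len R i.+1)) z) by [].
by apply/cvg_lim => //; apply: gf_scaled_diff_mean_len.
Qed.

End MeanLen.

(** * The exponential integral *)

Section ExpIntegral.
Local Open Scope classical_set_scope.
Variable R : realType.
Implicit Types (x y a b : R).
Local Notation mu := (@lebesgue_measure R).

Lemma integral_expN a : (\int[mu]_(x in `]a, +oo[) (expR (- x))%:E = (expR (- a))%:E)%E.
Proof.
have dF (x : R) : is_derive x (1 : R) (fun y : R => - expR (- y)) (expR (- x)).
  have d1 := is_derive1_comp (is_derive_expR (- x)) (is_deriveN (is_derive_id x (1 : R))).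
  by apply: is_derive_eq (is_deriveN d1) _; rewrite mulrN1 opprK.
have cF : continuous (fun y : R => - expR (- y)).
  by move=> x; apply: differentiable_continuous; apply/derivable1_diffP; have [] := dF x.
have cf : continuous (fun y : R => expR (- y)).
  move=> x; apply: (@continuous_comp _ _ _ (fun y : R => - y) expR).
    exact: opp_continuous.
  exact: continuous_expR.
rewrite integral_itv_obnd_cbnd; last first.
  apply/measurable_EFinP; apply: measurable_funTS; exact: continuous_measurable_fun.
rewrite (@ge0_continuous_FTC2y R _ (fun y => - expR (- y)) a 0) ?sub0e ?EFinN ?oppeK //.
- exact: continuous_subspaceT.
- by rewrite -oppr0; apply: cvgN; exact: cvgr_expR.
- exact/cvg_at_right_filter/cF.
- by move=> x _; rewrite derive1E; have [] := dF x.
Qed.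

Lemma measurable_expN (D : set R) : measurable D -> measurable_fun D (fun x => (expR (- x))%:E : \bar R).
Proof.
move=> mD; apply/measurable_EFinP; apply: measurable_funTS.
by apply: measurableT_comp => //; exact: measurable_expR.
Qed.

Lemma integrable_expN a : mu.-integrable `]a, +oo[ (EFin \o (fun x => expR (- x))).
Proof.
apply/integrableP; split; first exact: measurable_expN.
under eq_integral do rewrite /= ger0_norm ?expR_ge0 //.
by rewrite integral_expN ltry.
Qed.

Lemma Rintegral_expN a : \int[mu]_(x in `]a, +oo[) expR (- x) = expR (- a).
Proof. by rewrite /Rintegral integral_expN. Qed.

Lemma Rintegral_expN_itv a b : a <= b -> \int[mu]_(x in `]a, b]) expR (- x) = expR (- a) - expR (- b).
Proof.
move=> ab; have := Rintegral_itvB (x := b) (integrable_expN a).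
by rewrite !Rintegral_expN !bnd_simp => /(_ ab isT) <-; rewrite opprB addrC subrK.
Qed.

Definition E1_integrand x : R := x^-1 * expR (- x).

Lemma E1_integrand_ge0 x : 0 < x -> 0 <= E1_integrand x.
Proof. by move=> x0; rewrite mulr_ge0 ?expR_ge0 // invr_ge0 ltW. Qed.

Lemma E1_integrand_antitone x y : 0 < x -> x <= y -> E1_integrand y <= E1_integrand x.
Proof.
move=> x0 xy; have y0 := lt_le_trans x0 xy.
rewrite ler_pM ?expR_ge0 ?invr_ge0 ?(ltW y0) //; first by rewrite lef_pV2.
by rewrite ler_expR lerN2.
Qed.

Lemma measurable_E1_integrand : measurable_fun `](0 : R), +oo[ E1_integrand.
Proof.
apply: measurable_funM.
  apply: open_continuous_measurable_fun; first exact: interval_open.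
  by move=> x; rewrite inE /= in_itv /= andbT => x0; apply: inv_continuous; rewrite gt_eqF.
by apply/measurable_EFinP; apply: measurable_expN.
Qed.

Lemma integrable_E1_integrand a : 0 < a -> mu.-integrable `]a, +oo[ (EFin \o E1_integrand).
Proof.
move=> a0.
apply: (@le_integrable _ _ _ mu _ _ _ (fun x => (a^-1)%:E * (expR (- x))%:E)%E) => //.
- apply/measurable_EFinP; apply: measurable_funS measurable_E1_integrand => // x.
  by rewrite /= !in_itv /= !andbT; apply: lt_trans.
- move=> x; rewrite /= in_itv /= andbT => ax; have x0 := lt_trans a0 ax.
  rewrite lee_fin ger0_norm ?E1_integrand_ge0 // ger0_norm ?mulr_ge0 ?expR_ge0 ?invr_ge0 ?(ltW a0) //.
  by rewrite ler_wpM2r ?expR_ge0 // lef_pV2 // ltW.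
- by apply: integrableZl => //; exact: integrable_expN.
Qed.

Lemma E1B x y : 0 < x -> x <= y -> E1 x - E1 y = \int[mu]_(t in `]x, y]) E1_integrand t.
Proof.
move=> x0 xy; have := Rintegral_itvB (x := y) (integrable_E1_integrand x0).
rewrite !bnd_simp => /(_ xy isT) e; rewrite /E1 -/E1_integrand.
by rewrite -[X in _ - X]e opprB addrC subrK.
Qed.

Lemma integrable_E1_itv x y : 0 < x -> mu.-integrable `]x, y] (EFin \o E1_integrand).
Proof.
move=> x0; apply: integrableS (integrable_E1_integrand x0) => //.
by move=> t /=; rewrite !in_itv /= andbT => /andP[].
Qed.

Lemma lebesgue_measure_oc x y : x <= y -> fine (lebesgue_measure `]x, y]) = y - x.
Proof.
move=> xy; rewrite lebesgue_measure_itv /= lte_fin.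
by case: ltgtP xy => // ->; rewrite subrr.
Qed.

Lemma integrable_cst_oc x y r : mu.-integrable `]x, y] (EFin \o (fun=> r : R)).
Proof.
apply/integrableP; split; first exact: measurable_cst.
rewrite [X in (X < _)%E](_ : _ = (`|r|%:E * lebesgue_measure `]x, y])%E); last first.
  exact: (integral_cst mu).
by rewrite lebesgue_measure_itv /=; case: ifP => _; rewrite ?mule0 ?ltry // -EFinB -EFinM ltry.
Qed.

Lemma E1B_bounds x y : 0 < x -> x <= y ->
  (y - x) * E1_integrand y <= E1 x - E1 y <= (y - x) * E1_integrand x.
Proof.
move=> x0 xy; rewrite (E1B x0 xy).
have cstE r : \int[mu]_(t in `]x, y]) r = (y - x) * r.
  etransitivity; first exact: Rintegral_cst.
  by rewrite mulrC; congr (_ * _); apply: lebesgue_measure_oc.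
have icst r := @integrable_cst_oc x y r.
rewrite -!cstE; apply/andP; split; apply: le_Rintegral => //; try exact: integrable_E1_itv.
- move=> t; rewrite /= in_itv /= => /andP[xt ty]; apply: E1_integrand_antitone => //.
  exact: lt_trans xt.
- by move=> t; rewrite /= in_itv /= => /andP[xt ty]; apply: E1_integrand_antitone => //; apply: ltW.
Qed.

Lemma E1_antitone x y : 0 < x -> x <= y -> E1 y <= E1 x.
Proof.
move=> x0 xy; have /andP[h _] := E1B_bounds x0 xy; rewrite -subr_ge0; apply: le_trans h.
by rewrite mulr_ge0 ?subr_ge0 // E1_integrand_ge0 // (lt_le_trans x0).
Qed.

Lemma E1_ge0 x : 0 < x -> 0 <= E1 x.
Proof.
move=> x0; apply: Rintegral_ge0 => t; rewrite /= in_itv /= andbT => xt.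
by apply: E1_integrand_ge0; apply: lt_trans xt.
Qed.

Lemma E1_le x : 1 <= x -> E1 x <= expR (- x).
Proof.
move=> x1; have x0 : 0 < x by apply: lt_le_trans x1.
rewrite -Rintegral_expN; apply: le_Rintegral => //.
- exact: integrable_E1_integrand.
- exact: integrable_expN.
move=> t; rewrite /= in_itv /= andbT => xt.
rewrite ler_piMl ?expR_ge0 // invf_le1; first exact: le_trans x1 (ltW xt).
exact: lt_trans xt.
Qed.

(** E1 is monotone on the positive reals only; the extension by 0 of exp (- E1) is
    monotone everywhere, and E1 is recovered from it by a logarithm. *)
Lemma measurable_E1 : measurable_fun `](0 : R), +oo[ (@E1 R).
Proof.
pose f x := if 0 < x then expR (- E1 x) else 0.
have fm : {homo f : x y / x <= y}.
  move=> x y xy; rewrite /f; case: ifP => x0.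
    by rewrite (lt_le_trans x0 xy) ler_expR lerN2 E1_antitone.
  by case: ifP; rewrite ?expR_ge0.
have mf : measurable_fun setT f by apply: nondecreasing_measurable.
apply: (@eq_measurable_fun _ _ _ _ _ (fun x => - ln (f x))).
  by move=> x; rewrite inE /= in_itv /= andbT /f => ->; rewrite expRK opprK.
by apply: measurable_funTS; apply/measurable_funN; apply: measurableT_comp => //; exact: measurable_ln.
Qed.

End ExpIntegral.

(** * From Poisson weights to the integral *)

Section RiemannSum.
Local Open Scope classical_set_scope.
Variable R : realType.
Implicit Types (x y s : R) (i m n : nat).
Local Notation mu := (@lebesgue_measure R).

Lemma poisson_le1 i x : 0 <= x -> poisson i x <= 1.
Proof.
move=> x0; rewrite /poisson expRN ler_pdivrMr ?expR_gt0 // mul1r.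
case: i => [|i]; first by rewrite expr0 fact0 divr1 -[leLHS]addr0 (le_trans _ (expR_ge1Dx x)) // lerD2l.
by apply: le_trans (expR_ge1Dxn i x0); rewrite lerDr.
Qed.

Lemma is_derive_poisson i x : is_derive x (1 : R) (@poisson R i)
  ((if i is j.+1 then poisson j x else 0) - poisson i x).
Proof.
have d1 := is_deriveZ (i`!%:R^-1) (is_deriveX i (is_derive_id x (1 : R))).
have d2 := is_derive1_comp (is_derive_expR (- x)) (is_deriveN (is_derive_id x (1 : R))).
have -> : @poisson R i = (i`!%:R^-1 \*: (id ^+ i)) * (expR \o -%R).
  by apply/funext => y; rewrite /poisson !fctE /= /GRing.scale /= [_ / _]mulrC.
apply: is_derive_eq (is_deriveM d1 d2) _.
rewrite !fctE /poisson /GRing.scale /=; case: i {d1} => [|i].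
  by rewrite fact0 !expr0; field.
have h : (i`!%:R != 0 :> R) by rewrite pnatr_eq0 -lt0n fact_gt0.
rewrite factS natrM /=; field; rewrite h nat1r pnatr_eq0 //.
Qed.

(** The derivative is a difference of two Poisson probabilities. *)
Lemma poisson_lipschitz i x y : 0 <= x -> x <= y -> `|poisson i x - poisson i y| <= y - x.
Proof.
move=> x0 xy; rewrite distrC.
have [|c] := @MVT_segment R (@poisson R i) _ x y xy (fun t _ => is_derive_poisson i t).
  apply: derivable_within_continuous => t _; by have [] := is_derive_poisson i t.
rewrite in_itv /= => /andP[xc _] ->; have c0 := le_trans x0 xc.
rewrite normrM (ger0_norm (_ : 0 <= y - x)) ?subr_ge0 // ler_piMl ?subr_ge0 //.
have h1 := poisson_ge0 i c0; have h2 := poisson_le1 i c0.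
case: i h1 h2 => [|i] h1 h2; first by rewrite sub0r normrN ger0_norm.
have h3 := poisson_ge0 i c0; have h4 := poisson_le1 i c0.
by rewrite ler_norml; lra.
Qed.

(** The grid of step s, with z = exp (- s). *)
Section Grid.
Variables (s : R) (s0 : 0 < s).
Let z := expR (- s).

Lemma grid_z_bounds : 0 <= z /\ z < 1.
Proof. by split; [exact: expR_ge0|rewrite /z expR_lt1 oppr_lt0]. Qed.

Lemma grid_term k : (0 < k)%N -> k%:R^-1 * z ^+ k = s * E1_integrand (s * k%:R).
Proof.
move=> k0; rewrite /E1_integrand /z -expRM_natr mulNr invfM !mulrA.
by rewrite mulfV ?mul1r // gt_eqF.
Qed.

(** z^k / k is the value at s k of the decreasing integrand of E1, times the step
    s, so the tail of the series is a Riemann sum of E1 squeezed between two of its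
    values. *)
Lemma log_tail_bounds m : (E1 (s * m.+1%:R) <= log_tail m z) /\ ((0 < m)%N -> log_tail m z <= E1 (s * m%:R)).
Proof.
have [z0 z1] := grid_z_bounds; have nz : `|z| < 1 by rewrite ger0_norm.
pose c k : R := if (m < k)%N then k%:R^-1 else 0.
have c1 k : `|c k| <= 1.
  rewrite /c; case: ifP => mk; last by rewrite normr0.
  by rewrite ger0_norm ?invr_ge0 // invf_le1 ?ler1n ?ltr0n // (leq_ltn_trans _ mk).
have cv : cvgn (pseries c z) by apply: is_cvg_pseries_bounded c1 nz.
pose S n := pseries c z (m.+1 + n)%N.
have S0 : S 0%N = 0.
  rewrite /S addn0 /pseries /series /= big_mkord big1 // => k _.
  by rewrite /c ltnNge -ltnS ltn_ord /= mul0r.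
have SS n : S n.+1 = S n + s * E1_integrand (s * (m.+1 + n)%:R).
  rewrite /S addnS /pseries /series /= big_nat_recr //= -grid_term //.
  by rewrite /c leq_addr.
have sp k : (0 < k)%N -> 0 < s * k%:R by move=> k0; rewrite mulr_gt0 ?ltr0n.
have step k : (0 < k)%N -> s * E1_integrand (s * k.+1%:R) <= E1 (s * k%:R) - E1 (s * k.+1%:R) <= s * E1_integrand (s * k%:R).
  move=> k0; have := @E1B_bounds R (s * k%:R) (s * k.+1%:R) (sp _ k0).
  rewrite ler_wpM2l ?ler_nat // ?(ltW s0) // => /(_ isT).
  by rewrite -mulrBr -natrB ?leqnSn // subSnn mulr1.
have low n : E1 (s * m.+1%:R) - E1 (s * (m.+1 + n)%:R) <= S n.
  elim: n => [|n IH]; first by rewrite addn0 subrr S0.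
  rewrite SS addnS; have /andP[_] := step (m.+1 + n)%N isT; lra.
have up n : (0 < m)%N -> S n <= E1 (s * m%:R) - E1 (s * (m + n)%:R).
  move=> m0; elim: n => [|n IH]; first by rewrite addn0 subrr S0.
  rewrite SS addnS addSn; have /andP[h _] := step (m + n)%N (ltn_addr n m0); lra.
have cS : S @ \oo --> log_tail m z.
  have h : pseries c z @ \oo --> log_tail m z := cv.
  by move: h; rewrite -(cvg_shiftn m.+1); apply: cvg_trans; apply: near_eq_cvg; apply: nearW => n; rewrite /S addnC.
split; last first.
  move=> m0; rewrite -(cvg_lim (@Rhausdorff R) cS); apply: limr_le; first by apply: cvgP cS.
  apply: nearW => n; apply: le_trans (up n m0) _; rewrite gerBl E1_ge0 // sp //.
  by rewrite addn_gt0 m0.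
have h0 : (fun n => S n + z ^+ (m.+1 + n)%N) @ \oo --> log_tail m z.
  have g0 : (fun n => z ^+ (m.+1 + n)%N) @ \oo --> (0 : R).
    have := cvg_geometric (z ^+ m.+1) nz; apply: cvg_trans; apply: near_eq_cvg.
    by apply: nearW => n; rewrite /= exprD.
  by have := cvgD cS g0; rewrite addr0; apply.
rewrite -(cvg_lim (@Rhausdorff R) h0); apply: limr_ge; first by apply: cvgP h0.
exists (Num.truncn s^-1).+1 => // n /= nN.
rewrite -lerBlDr; apply: le_trans (low n); rewrite lerD2l lerN2 /z -expRM_natr mulNr.
apply: E1_le; rewrite mulrC -ler_pdivrMr // div1r.
apply: le_trans (ltW (truncnS_gt _)) _; rewrite ler_nat.
exact: leq_trans nN (leq_addl _ _).
Qed.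

(** On ]0, +oo[ this is 1 / i! times the integrand of [G1 R i.+1]. *)
Definition density i x : R := expR (- x) * poisson i (E1 x).

Lemma density_bounds i x : 0 < x -> 0 <= density i x <= expR (- x).
Proof.
move=> x0; have e0 := E1_ge0 x0.
rewrite /density mulr_ge0 ?expR_ge0 ?poisson_ge0 //=.
by rewrite ler_piMr ?expR_ge0 ?poisson_le1.
Qed.

Lemma integrable_density i : mu.-integrable `](0 : R), +oo[ (EFin \o density i).
Proof.
apply: (@le_integrable _ _ _ mu _ _ _ (EFin \o (fun x => expR (- x)))) => //.
- apply/measurable_EFinP; apply: measurable_funM.
    by apply/measurable_EFinP; apply: measurable_expN.
  apply: measurable_funM; first apply: measurable_funM; last first.
  + have h : measurable_fun setT (fun y : R => expR (- y)) by apply/measurable_EFinP; apply: measurable_expN.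
    exact: measurableT_comp h (@measurable_E1 R).
  + exact: measurable_cst.
  + by apply: measurable_funX; apply: measurable_E1.
- move=> x; rewrite /= in_itv /= andbT => x0; have /andP[h1 h2] := density_bounds i x0.
  by rewrite lee_fin !ger0_norm ?expR_ge0.
- exact: integrable_expN.
Qed.

Lemma integrable_density_itv i a b : 0 <= a -> mu.-integrable `]a, b] (EFin \o density i).
Proof.
move=> a0; apply: integrableS (integrable_density i) => //.
by move=> t /=; rewrite !in_itv /= andbT => /andP[/(le_lt_trans a0)].
Qed.

(** For m > 0, both E1 x and log_tail m z lie between E1 (s (m + 1)) and E1 (s m), which
    differ by at most z^m / m. *)
Lemma poisson_grid_close i m x : s * m%:R < x -> x <= s * m.+1%:R ->
  `|poisson i (E1 x) - poisson i (log_tail m z)| <= 2 / m.+1%:R.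
Proof.
move=> mx xm; have [z0 z1] := grid_z_bounds.
have x0 : 0 < x by apply: le_lt_trans mx; rewrite mulr_ge0 // ltW.
have [l1 l2] := log_tail_bounds m.
have sm0 : 0 < s * m.+1%:R by rewrite mulr_gt0 ?ltr0n.
have lam0 : 0 <= log_tail m z by apply: le_trans l1; apply: E1_ge0.
have e0 := E1_ge0 x0.
case: m mx xm l1 l2 sm0 lam0 => [|m] mx xm l1 l2 sm0 lam0.
  rewrite divr1; have p1 := poisson_ge0 i e0; have p2 := poisson_le1 i e0.
  have p3 := poisson_ge0 i lam0; have p4 := poisson_le1 i lam0.
  by rewrite ler_norml; lra.
have {}l2 := l2 isT.
have sm : 0 < s * m.+1%:R by rewrite mulr_gt0 ?ltr0n.
have d : `|E1 x - log_tail m.+1 z| <= m.+1%:R^-1.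
  have h1 : E1 (s * m.+2%:R) <= E1 x by apply: E1_antitone.
  have h2 : E1 x <= E1 (s * m.+1%:R) by apply: E1_antitone => //; apply: ltW.
  have smm : s * m.+1%:R <= s * m.+2%:R by rewrite ler_wpM2l ?ler_nat // ltW.
  have /andP[_ h3] := E1B_bounds sm smm.
  have h4 : (s * m.+2%:R - s * m.+1%:R) * E1_integrand (s * m.+1%:R) <= m.+1%:R^-1.
    rewrite -mulrBr -natrB ?leqnSn // subSnn mulr1 -grid_term //.
    by rewrite ler_piMr ?invr_ge0 // exprn_ile1 // ltW.
  have {}h3 := le_trans h3 h4.
  by rewrite ler_norml; move: h3; move: (m.+1%:R^-1 : R) => y h3; apply/andP; split; lra.
have : `|poisson i (E1 x) - poisson i (log_tail m.+1 z)| <= `|E1 x - log_tail m.+1 z|.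
  have [h|h] := leP (E1 x) (log_tail m.+1 z).
    by apply: le_trans (poisson_lipschitz i e0 h) _; rewrite distrC ler_norm.
  by rewrite distrC; apply: le_trans (poisson_lipschitz i lam0 (ltW h)) _; rewrite ler_norm.
move=> /le_trans; apply; apply: le_trans d _.
by rewrite ler_pdivlMr ?ltr0n // mulrC ler_pdivrMr ?ltr0n // -natrM ler_nat; lia.
Qed.

(** The weight (1 - z) z^m is the integral of exp (- x) over the m-th cell. *)
Lemma density_piece i m :
  `|\int[mu]_(x in `](s * m%:R), (s * m.+1%:R)]) density i x - (1 - z) * (poisson i (log_tail m z) * z ^+ m)|
  <= (1 - z) * z ^+ m * (2 / m.+1%:R).
Proof.
have sm : s * m%:R <= s * m.+1%:R by rewrite ler_wpM2l ?ler_nat // ltW.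
have sm0 : 0 <= s * m%:R by rewrite mulr_ge0 // ltW.
have E : \int[mu]_(x in `](s * m%:R), (s * m.+1%:R)]) expR (- x) = (1 - z) * z ^+ m.
  rewrite Rintegral_expN_itv // /z -!mulNr !expRM_natr exprS; ring.
set P := poisson i (log_tail m z); set d := 2 / m.+1%:R.
have iE : mu.-integrable `](s * m%:R), (s * m.+1%:R)] (EFin \o (fun x => expR (- x))).
  apply: integrableS (integrable_expN (s * m%:R)) => //.
  by move=> t /=; rewrite !in_itv /= andbT => /andP[].
have iEr r : mu.-integrable `](s * m%:R), (s * m.+1%:R)] (EFin \o (fun x => r * expR (- x))).
  exact: (integrableZl _ r iE).
have lo : \int[mu]_(x in `](s * m%:R), (s * m.+1%:R)]) ((P - d) * expR (- x)) <=
   \int[mu]_(x in `](s * m%:R), (s * m.+1%:R)]) density i x.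
  apply: le_Rintegral => //; first exact: integrable_density_itv.
  move=> x; rewrite /= in_itv /= => /andP[h1 h2]; rewrite /density mulrC ler_wpM2l ?expR_ge0 //.
  by have := poisson_grid_close i h1 h2; rewrite ler_distl => /andP[].
have hi : \int[mu]_(x in `](s * m%:R), (s * m.+1%:R)]) density i x <=
   \int[mu]_(x in `](s * m%:R), (s * m.+1%:R)]) ((P + d) * expR (- x)).
  apply: le_Rintegral => //; first exact: integrable_density_itv.
  move=> x; rewrite /= in_itv /= => /andP[h1 h2]; rewrite /density [leRHS]mulrC ler_wpM2l ?expR_ge0 //.
  by have := poisson_grid_close i h1 h2; rewrite ler_distl => /andP[].
move: lo hi; rewrite !RintegralZl // E ler_distl => lo hi; apply/andP; split.
  by apply: le_trans lo; rewrite le_eqVlt; apply/orP; left; apply/eqP; ring.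
by apply: le_trans hi _; rewrite le_eqVlt; apply/orP; left; apply/eqP; ring.
Qed.

Lemma density_partial i n :
  `|\int[mu]_(x in `](0 : R), (s * n%:R)]) density i x -
     (1 - z) * \sum_(m < n) poisson i (log_tail m z) * z ^+ m|
  <= (1 - z) * \sum_(m < n) z ^+ m * (2 / m.+1%:R).
Proof.
elim: n => [|n IH].
  by rewrite !big_ord0 !mulr0 set_itvoc0 Rintegral_set0 subrr normr0.
have sn : s * n%:R <= s * n.+1%:R by rewrite ler_wpM2l ?ler_nat // ltW.
have sn0 : 0 <= s * n%:R by rewrite mulr_ge0 // ltW.
have := Rintegral_itvB (x := s * n%:R) (integrable_density_itv i (s * n.+1%:R) (lexx 0)).
rewrite !bnd_simp => /(_ sn0 sn) /eqP; rewrite subr_eq => /eqP ->.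
rewrite !big_ord_recr /= !mulrDr.
have -> (a b c d : R) : a + b - (c + d) = (b - c) + (a - d) by ring.
apply: le_trans (ler_normD _ _) _; apply: lerD => //.
by apply: le_trans (density_piece i n) _; rewrite [leRHS]mulrA.
Qed.

Lemma density_total i (e : R) (M : nat) : 0 < e ->
  (forall m, m.+1%:R^-1 <= e + (m < M)%N%:R) ->
  `|(1 - z) * limn (pseries (fun m => poisson i (log_tail m z)) z) -
    \int[mu]_(x in `](0 : R), +oo[) density i x| <= 2 * e + 2 * M%:R * (1 - z).
Proof.
move=> e0 hM; have [z0 z1] := grid_z_bounds; have nz : `|z| < 1 by rewrite ger0_norm.
set I := \int[mu]_(x in _) _; set l := limn _.
have z1p : 0 < 1 - z by rewrite subr_gt0.
have key (t b : R) : 0 <= b -> t * b <= b -> t * (2 * (e + b)) <= 2 * e * t + 2 * b.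
  move=> b0 tb; rewrite -subr_ge0 (_ : _ - _ = 2 * (b - t * b)); last by ring.
  by rewrite mulr_ge0 ?subr_ge0.
have cv : cvgn (pseries (fun m => poisson i (log_tail m z)) z).
  apply: (@is_cvg_pseries_bounded _ _ _ 1 _ nz) => m.
  have l0 : 0 <= log_tail m z.
    by apply: le_trans (log_tail_bounds m).1; apply: E1_ge0; rewrite mulr_gt0 ?ltr0n.
  by rewrite ger0_norm ?poisson_ge0 ?poisson_le1.
have main n : `|I - (1 - z) * pseries (fun m => poisson i (log_tail m z)) z n| <=
    2 * e + 2 * M%:R * (1 - z) + z ^+ n.
  have sn0 : 0 <= s * n%:R by rewrite mulr_ge0 // ltW.
  have := Rintegral_itvB (x := s * n%:R) (integrable_density i).
  rewrite !bnd_simp => /(_ sn0 isT) tail.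
  have t0 : 0 <= \int[mu]_(x in `](s * n%:R), +oo[) density i x.
    apply: Rintegral_ge0 => x; rewrite /= in_itv /= andbT => /(le_lt_trans sn0) x0.
    by have /andP[] := density_bounds i x0.
  have t1 : \int[mu]_(x in `](s * n%:R), +oo[) density i x <= z ^+ n.
    rewrite (_ : z ^+ n = expR (- (s * n%:R))); last by rewrite -mulNr expRM_natr.
    rewrite -Rintegral_expN; apply: le_Rintegral => //.
    - apply: integrableS (integrable_density i) => // x.
      by rewrite /= !in_itv /= !andbT => /(le_lt_trans sn0).
    - exact: integrable_expN.
    move=> x; rewrite /= in_itv /= andbT => /(le_lt_trans sn0) x0.
    by have /andP[] := density_bounds i x0.
  have d := density_partial i n.
  have b : (1 - z) * \sum_(m < n) z ^+ m * (2 / m.+1%:R) <= 2 * e + 2 * M%:R * (1 - z).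
    apply: le_trans (_ : (1 - z) * \sum_(m < n) (2 * e * z ^+ m + 2 * (m < M)%N%:R) <= _).
      rewrite ler_wpM2l ?(ltW z1p) //; apply: ler_sum => m _.
      have zm0 : 0 <= z ^+ m by rewrite exprn_ge0.
      have zm1 : z ^+ m <= 1 by rewrite exprn_ile1 // ltW.
      apply: le_trans (ler_wpM2l zm0 (ler_wpM2l (ler0n _ 2) (hM m))) _.
      by apply: key; [exact: ler0n|rewrite ler_piMl].
    rewrite big_split /= -!mulr_sumr mulrDr; apply: lerD.
      rewrite mulrCA ler_piMr ?mulr_ge0 ?(ltW e0) //.
      have -> : (1 - z) * \sum_(i0 < n) z ^+ i0 = 1 - z ^+ n.
        by rewrite -[RHS]opprB subrX1 -mulNr opprB.
      by rewrite gerBl exprn_ge0.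
    rewrite [leRHS]mulrC ler_wpM2l ?(ltW z1p) // ler_wpM2l // -natr_sum ler_nat.
    rewrite -(big_mkord xpredT (fun m => nat_of_bool (m < M)))%N.
    exact: sum_ltn_le.
  rewrite /pseries /series /= big_mkord.
  move: d tail t0 t1 b; rewrite -/I !ler_norml.
  set A := \int[mu]_(x in `](0 : R), (s * n%:R)]) _; set T := \int[mu]_(x in _) _.
  set Sm := \sum_(m < n) poisson i _ * _; set B := (1 - z) * \sum_(m < n) _.
  by move=> d tail t0 t1 b; lra.
have cl : (fun n => (1 - z) * pseries (fun m => poisson i (log_tail m z)) z n) @ \oo --> (1 - z) * l.
  exact: cvgM (cvg_cst _) cv.
have cN : (fun n => `|I - (1 - z) * pseries (fun m => poisson i (log_tail m z)) z n| - z ^+ n) @ \oo -->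
   `|I - (1 - z) * l|.
  have zn0 : (fun n => z ^+ n) @ \oo --> (0 : R).
    by have := cvg_geometric 1 nz; apply: cvg_trans; apply: near_eq_cvg; apply: nearW => n; rewrite /= mul1r.
  have h : (fun n => `|I - (1 - z) * pseries (fun m => poisson i (log_tail m z)) z n|) @ \oo -->
     `|I - (1 - z) * l|.
    by apply: cvg_norm; apply: cvgB cl; apply: cvg_cst.
  by have := cvgB h zn0; rewrite subr0; apply.
rewrite distrC -(cvg_lim (@Rhausdorff R) cN); apply: limr_le; first by apply: cvgP cN.
by apply: nearW => n; rewrite lerBlDr.
Qed.

End Grid.
End RiemannSum.

(** * The limit constant *)

Section Constant.
Local Open Scope classical_set_scope.
Variable R : realType.
Implicit Types (x y s : R) (i m n : nat).
Local Notation mu := (@lebesgue_measure R).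

Lemma poisson_cvg0 i : poisson i x @[x --> +oo] --> (0 : R).
Proof.
have h : (fun x : R => i.+1%:R * x^-1) x @[x --> +oo] --> (0 : R).
  have v : (fun x : R => x^-1) x @[x --> +oo] --> (0 : R).
    by apply/gtr0_cvgV0; [exact: nbhs_pinfty_gt|exact: cvg_id].
  by have := cvgM (cvg_cst (i.+1%:R : R)) v; rewrite mulr0; apply.
apply: (squeeze_cvgr _ (cvg_cst (0 : R)) h).
near=> x.
have x0 : 0 < x by [].
apply/andP; split; first by rewrite poisson_ge0 // ltW.
rewrite /= ler_pdivlMr //.
have -> : poisson i x * x = i.+1%:R * poisson i.+1 x.
  rewrite /poisson factS natrM exprS.
  have k0 : (i`!%:R != 0 :> R) by rewrite pnatr_eq0 -lt0n fact_gt0.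
  by field; rewrite k0 nat1r pnatr_eq0.
by rewrite ler_piMr // poisson_le1 // ltW.
Unshelve. all: by end_near. Qed.

Lemma continuous_poisson i : continuous (@poisson R i).
Proof.
move=> x; apply: differentiable_continuous; apply/derivable1_diffP.
by have [] := is_derive_poisson i x.
Qed.

(** - i! * sum_(j <= i) poisson j is a primitive of the integrand. *)
Lemma Gamma_succ i : Gamma (i.+1%:R : R) = i`!%:R.
Proof.
pose F x : R := - (i`!%:R * \sum_(j < i.+1) poisson j x).
have dF x : is_derive x (1 : R) F (i`!%:R * poisson i x).
  have dS k : is_derive x (1 : R) (fun y => \sum_(j < k.+1) poisson j y) (- poisson k x).
    elim: k => [|k IH].
      have -> : (fun y => \sum_(j < 1) poisson j y) = @poisson R 0.
        by apply/funext => y; rewrite big_ord1.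
      by apply: is_derive_eq (is_derive_poisson 0 x) _; rewrite sub0r.
    have -> : (fun y => \sum_(j < k.+2) poisson j y) =
       (fun y => \sum_(j < k.+1) poisson j y) + @poisson R k.+1.
      by apply/funext => y; rewrite big_ord_recr.
    by apply: is_derive_eq (is_deriveD IH (is_derive_poisson k.+1 x)) _; rewrite addKr.
  have := is_deriveN (is_deriveZ (i`!%:R) (dS i)) => d.
  by apply: is_derive_eq d _; rewrite scalerN opprK.
have cF : continuous F.
  by move=> x; apply: differentiable_continuous; apply/derivable1_diffP; have [] := dF x.
have cf : continuous (fun x : R => i`!%:R * poisson i x).
  by move=> x; apply: cvgM; [exact: cvg_cst|exact: continuous_poisson].
rewrite /Gamma /Rintegral.
transitivity (fine (\int[mu]_(x in `]0%R, +oo[) (i`!%:R * poisson i x)%:E)%E).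
  congr fine; apply: eq_integral => x; rewrite inE /= in_itv /= andbT => x0; congr EFin.
  have k0 : (i`!%:R != 0 :> R) by rewrite pnatr_eq0 -lt0n fact_gt0.
  rewrite -natr1 addrK powR_mulrn ?(ltW x0) // /poisson mulrA; congr (_ * _).
  by rewrite mulrC divfK.
rewrite integral_itv_obnd_cbnd; last first.
  by apply/measurable_EFinP; apply: measurable_funTS; apply: continuous_measurable_fun.
rewrite (@ge0_continuous_FTC2y R _ F 0 0) //.
- rewrite sub0e /F -EFinN opprK big_ord_recl big1 => [|j _]; last first.
    by rewrite /poisson /= expr0n mul0r mul0r.
  by rewrite /poisson expr0 oppr0 expR0 fact0 divr1 !mulr1 addr0 mulr1.
- by move=> x x0; rewrite mulr_ge0 ?poisson_ge0.
- exact: continuous_subspaceT.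
- have s0 k : (fun x : R => \sum_(j < k) poisson j x) x @[x --> +oo] --> (0 : R).
    elim: k => [|k IH].
      by under eq_fun do rewrite big_ord0; apply: cvg_cst.
    under eq_fun do rewrite big_ord_recr.
    by have := cvgD IH (poisson_cvg0 k); rewrite addr0; apply.
  by have := cvgN (cvgM (cvg_cst (i`!%:R : R)) (s0 i.+1)); rewrite mulr0 oppr0; apply.
- exact/cvg_at_right_filter/cF.
- by move=> x _; rewrite derive1E; have [] := dF x.
Qed.

Lemma G1E i : G1 R i.+1 = \int[mu]_(x in `](0 : R), +oo[) density i x.
Proof.
rewrite /G1 Gamma_succ subn1 /=.
have k0 : (i`!%:R != 0 :> R) by rewrite pnatr_eq0 -lt0n fact_gt0.
transitivity ((i`!%:R)^-1 * \int[mu]_(x in `](0 : R), +oo[) (i`!%:R * density i x)).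
  congr (_ * _); apply: eq_Rintegral => x _; rewrite /density /poisson addrC expRD; field.
  by rewrite k0.
by rewrite RintegralZl //; [rewrite mulKf|exact: integrable_density].
Qed.

(** Abel summation and the Riemann sum approximate the same quantity, for every z < 1,
    up to errors that vanish as z tends to 1. *)
Lemma mean_len_slope i c : linear_growth (mean_len R i.+1) c -> c = G1 R i.+1.
Proof.
move=> lg; rewrite G1E; set I := \int[mu]_(x in _) _.
apply/eqP; rewrite -subr_eq0 -normr_le0 leNgt; apply/negP => cI.
set e := `|c - I| / 5; have e0 : 0 < e by rewrite divr_gt0.
have [C hC] := abel_poisson lg e0; have [M hM] := inv_succ_le e0.
pose s := e / (`|C| + 2 * M%:R + 1).
have d0 : 0 < `|C| + 2 * M%:R + 1 by rewrite ltr_wpDl // addr_ge0 // mulr_ge0.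
have s0 : 0 < s by rewrite divr_gt0.
have [z0 z1] := grid_z_bounds s0.
have h1 := hC _ z0 z1; have h2 := density_total s0 i e0 hM.
have z1p : 0 < 1 - expR (- s) by rewrite subr_gt0.
have zs : 1 - expR (- s) <= s by have := expR_ge1Dx (- s); lra.
have h3 : (C + 2 * M%:R) * (1 - expR (- s)) <= e.
  apply: le_trans (_ : (`|C| + 2 * M%:R + 1) * (1 - expR (- s)) <= _).
    by rewrite ler_wpM2r ?(ltW z1p) //; have := ler_norm C; lra.
  by apply: le_trans (ler_wpM2l (ltW d0) zs) _; rewrite /s mulrC divfK // gt_eqF.
have ce : `|c - I| = 5 * e by rewrite /e mulrC divfK.
move: h1 h2; set X := (1 - expR (- s)) * limn _; rewrite -/I distrC => h1 h2.
have := ler_distD X c I; rewrite ce.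
rewrite mulrDl in h3.
lra.
Qed.

End Constant.

(** * The Gaussian sum *)

Section GaussSum.
Local Open Scope classical_set_scope.
Variable R : realType.
Implicit Types (x y h : R) (n l : nat).
Local Notation mu := (@lebesgue_measure R).

Lemma gauss_fun_antitone x y : 0 <= x -> x <= y -> gauss_fun y <= gauss_fun x.
Proof.
move=> x0 xy; rewrite /gauss_fun ler_expR lerN2 lerXn2r // nnegrE //.
exact: le_trans xy.
Qed.

Lemma integrable_gauss (D : set R) : measurable D -> mu.-integrable D (EFin \o gauss_fun).
Proof. by move=> mD; apply: integrableS (@integrableT_gauss R). Qed.

Definition gauss_int x : R := \int[mu]_(t in `](0 : R), x]) gauss_fun t.

Definition gauss_half : R := Num.sqrt pi / 2.

Lemma Rintegral_gauss : \int[mu]_(t in `](0 : R), +oo[) gauss_fun t = gauss_half.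
Proof.
have -> : \int[mu]_(t in `](0 : R), +oo[) gauss_fun t = \int[mu]_(t in `[(0 : R), +oo[) gauss_fun t.
  by apply: Rintegral_itv_obnd_cbnd; apply: integrable_gauss.
have := @integral0y_gauss R; rewrite /Rintegral => ->; by [].
Qed.

Lemma gauss_int_le x : 0 <= x -> gauss_int x <= gauss_half.
Proof.
move=> x0; rewrite -Rintegral_gauss.
have := @Rintegral_itvB R gauss_fun (BRight 0) (BInfty R false) x (integrable_gauss (measurable_itv _)).
rewrite !bnd_simp => /(_ x0 isT) e; rewrite -subr_ge0 e; apply: Rintegral_ge0 => t _.
exact: gauss_fun_ge0.
Qed.

(** For x >= 1 the tail is at most that of exp (- t); the constant 1 + gauss_half makes
    the bound trivial for x < 1. *)
Lemma gauss_int_ge x : 0 < x -> gauss_half - (1 + gauss_half) / x <= gauss_int x.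
Proof.
move=> x0; have g0 : 0 <= gauss_half by rewrite divr_ge0 ?sqrtr_ge0.
have i0 : 0 <= gauss_int x by apply: Rintegral_ge0 => t _; apply: gauss_fun_ge0.
have [x1|x1] := leP 1 x; last first.
  apply: le_trans i0; rewrite subr_le0 ler_pdivlMr // (le_trans (ler_piMr g0 (ltW x1))) // lerDr //.
have := @Rintegral_itvB R gauss_fun (BRight 0) (BInfty R false) x (integrable_gauss (measurable_itv _)).
rewrite !bnd_simp Rintegral_gauss => /(_ (ltW x0) isT) e.
have : \int[mu]_(t in `]x, +oo[) gauss_fun t <= expR (- x).
  rewrite -Rintegral_expN; apply: le_Rintegral => //.
  - exact: integrable_gauss.
  - exact: integrable_expN.
  move=> t; rewrite /= in_itv /= andbT => xt; rewrite /gauss_fun ler_expR lerN2.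
  by rewrite expr2 ler_peMl // (le_trans (ltW x0) (ltW xt), le_trans x1 (ltW xt)).
have : expR (- x) <= (1 + gauss_half) / x.
  rewrite expRN ler_pdivlMr // mulrC ler_pdivrMr ?expR_gt0 //.
  have := expR_ge1Dx x; have := mulr_ge0 g0 (expR_ge0 x); lra.
rewrite -/(gauss_int x) in e; lra.
Qed.

Lemma gauss_sum_bounds h n : 0 < h ->
  gauss_int (n%:R * h) <= h * \sum_(l < n) gauss_fun (l%:R * h) /\
  h * \sum_(l < n) gauss_fun (l.+1%:R * h) <= gauss_int (n%:R * h).
Proof.
move=> h0; elim: n => [|n [IH1 IH2]].
  by rewrite /gauss_int !big_ord0 mul0r mulr0 set_itvoc0 Rintegral_set0.
have nh0 : 0 <= n%:R * h by rewrite mulr_ge0 // ltW.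
have nn : n%:R * h <= n.+1%:R * h by rewrite ler_wpM2r ?ler_nat // ltW.
have := @Rintegral_itvB R gauss_fun (BRight 0) (BRight (n.+1%:R * h)) (n%:R * h) (integrable_gauss (measurable_itv _)).
rewrite !bnd_simp => /(_ nh0 nn) e; rewrite -!/(gauss_int _) in e.
have cst r : \int[mu]_(t in `](n%:R * h), (n.+1%:R * h)]) r = h * r.
  etransitivity; first exact: Rintegral_cst.
  rewrite mulrC; congr (_ * _); etransitivity; first exact: lebesgue_measure_oc.
  by rewrite -natr1; ring.
have ic r : mu.-integrable `](n%:R * h), (n.+1%:R * h)] (EFin \o (fun=> r : R)).
  exact: integrable_cst_oc.
have lo : h * gauss_fun (n.+1%:R * h) <= \int[mu]_(t in `](n%:R * h), (n.+1%:R * h)]) gauss_fun t.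
  rewrite -cst; apply: le_Rintegral => //; first exact: integrable_gauss.
  move=> t; rewrite /= in_itv /= => /andP[h1 h2]; apply: gauss_fun_antitone => //.
  exact: le_trans nh0 (ltW h1).
have hi : \int[mu]_(t in `](n%:R * h), (n.+1%:R * h)]) gauss_fun t <= h * gauss_fun (n%:R * h).
  rewrite -cst; apply: le_Rintegral => //; first exact: integrable_gauss.
  by move=> t; rewrite /= in_itv /= => /andP[h1 h2]; apply: gauss_fun_antitone => //; apply: ltW.
rewrite !big_ord_recr /= !mulrDr.
move/eqP: e; rewrite subr_eq addrC => /eqP ->.
by split; apply: lerD.
Qed.

(** The probability that l + 1 independent uniform elements of a set of size N are
    distinct, namely prod_(i <= l) (1 - i / N). *)
Definition distinct_prob N l : R := (N ^_ l.+1)%:R / (N ^ l.+1)%:R.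

Lemma distinct_probS N l : (0 < N)%N -> distinct_prob N l.+1 = distinct_prob N l * ((N - l.+1)%N%:R / N%:R).
Proof.
move=> N0; rewrite /distinct_prob ffactnSr expnSr !natrM invfM; ring.
Qed.

Lemma distinct_prob0 N : (0 < N)%N -> distinct_prob N 0 = 1.
Proof. by move=> N0; rewrite /distinct_prob ffactn1 expn1 divff // pnatr_eq0 -lt0n. Qed.

Lemma distinct_prob_ge0 N l : 0 <= distinct_prob N l.
Proof. by rewrite /distinct_prob divr_ge0. Qed.

(** From 1 - t <= exp (- t). *)
Lemma distinct_prob_le_gauss N l : (l < N)%N ->
  distinct_prob N l <= gauss_fun (l%:R / Num.sqrt (2 * N%:R)).
Proof.
move=> lN; have N0 : (0 < N)%N by apply: leq_trans lN.
have N0R : (0 : R) < N%:R by rewrite ltr0n.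
suff : distinct_prob N l <= expR (- (l%:R * l.+1%:R / (2 * N%:R))).
  move=> /le_trans; apply; rewrite /gauss_fun ler_expR lerN2 exprMn exprVn sqr_sqrtr ?mulr_ge0 //.
  by rewrite ler_wpM2r ?invr_ge0 ?mulr_ge0 // expr2 ler_wpM2l // ler_nat.
elim: l lN => [|l IH] lN; first by rewrite distinct_prob0 // !mul0r oppr0 expR0.
rewrite distinct_probS //.
have -> : expR (- (l.+1%:R * l.+2%:R / (2 * N%:R))) =
   expR (- (l%:R * l.+1%:R / (2 * N%:R))) * expR (- (l.+1%:R / N%:R)) :> R.
  by rewrite -expRD; congr expR; rewrite -!natr1; field; rewrite gt_eqF.
apply: ler_pM; rewrite ?distinct_prob_ge0 ?divr_ge0 ?IH ?(ltnW lN) //.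
apply: le_trans (expR_ge1Dx _); rewrite natrB ?(ltnW lN) // mulrBl divff ?gt_eqF //.
Qed.

(** From 1 - t >= exp (- t / (1 - t)), where 1 / (1 - t) <= 1 / (1 - d) for t <= d. *)
Lemma distinct_prob_ge_gauss N l (d : R) : 0 < d -> d < 1 -> (l%:R + 1 <= d * N%:R) ->
  gauss_fun (l.+1%:R / Num.sqrt (2 * ((1 - d) * N%:R))) <= distinct_prob N l.
Proof.
move=> d0 d1 lN.
have dN : 0 < d * N%:R by apply: lt_le_trans lN; rewrite ltr_wpDl.
have N0R : (0 : R) < N%:R by rewrite -(pmulr_rgt0 _ d0).
have N0 : (0 < N)%N by rewrite -(ltr0n R).
have dp : 0 < 1 - d by rewrite subr_gt0.
suff : expR (- (l%:R * l.+1%:R / (2 * ((1 - d) * N%:R)))) <= distinct_prob N l.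
  apply: le_trans; rewrite /gauss_fun ler_expR lerN2 exprMn exprVn sqr_sqrtr; last first.
    by rewrite !mulr_ge0 // ltW.
  rewrite ler_wpM2r ?invr_ge0 ?mulr_ge0 ?(ltW dp) // expr2 ler_wpM2r // ler_nat //.
elim: l lN => [|l IH] lN; first by rewrite distinct_prob0 // !mul0r oppr0 expR0.
rewrite distinct_probS //.
have -> : expR (- (l.+1%:R * l.+2%:R / (2 * ((1 - d) * N%:R)))) =
   expR (- (l%:R * l.+1%:R / (2 * ((1 - d) * N%:R)))) * expR (- (l.+1%:R / ((1 - d) * N%:R))).
  by rewrite -expRD; congr expR; rewrite -!natr1; field; rewrite !gt_eqF.
have lN' : l%:R + 1 <= d * N%:R by apply: le_trans lN; rewrite -natr1; lra.
have l1N : l.+1%:R < (N%:R : R).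
  have : d * N%:R < N%:R by rewrite gtr_pMl.
  by move: lN; rewrite natr1; lra.
have Nl : (0 : R) < N%:R - l.+1%:R by rewrite subr_gt0.
apply: ler_pM; rewrite ?expR_ge0 ?IH //.
rewrite natrB; last by rewrite -(ler_nat R) ltW.
rewrite expRN -[leRHS]invrK lef_pV2 ?posrE ?expR_gt0 ?invr_gt0 ?divr_gt0 //.
apply: le_trans (expR_ge1Dx _); rewrite invf_div.
have -> : N%:R / (N%:R - l.+1%:R) = 1 + l.+1%:R / (N%:R - l.+1%:R) :> R.
  by move: (l.+1%:R : R) Nl => y Ny; field; rewrite gt_eqF.
rewrite lerD2l ler_wpM2l // lef_pV2 ?posrE ?mulr_gt0 //.
by move: lN; rewrite mulrBl mul1r natr1; lra.
Qed.

Definition sum_distinct_prob n : R := \sum_(l < n) distinct_prob n.+1 l.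

Lemma gauss_half_ge0 : 0 <= gauss_half.
Proof. by rewrite divr_ge0 ?sqrtr_ge0. Qed.

Lemma sum_distinct_prob_le n : sum_distinct_prob n <= 1 + gauss_half * Num.sqrt (2 * n.+1%:R).
Proof.
set q := Num.sqrt _; have q0 : 0 < q by rewrite sqrtr_gt0 mulr_gt0 ?ltr0n.
apply: le_trans (_ : \sum_(l < n) gauss_fun (l%:R * q^-1) <= _).
  by apply: ler_sum => l _; apply: distinct_prob_le_gauss; apply: leq_trans (ltn_ord l) _.
case: n @q q0 => [|k] q q0.
  by rewrite big_ord0 addr_ge0 // mulr_ge0 ?gauss_half_ge0 ?sqrtr_ge0.
rewrite big_ord_recl; apply: lerD; first exact: gauss_fun_le1.
rewrite -ler_pdivrMr // mulrC.
have kq : 0 <= k%:R * q^-1 by rewrite mulr_ge0 // invr_ge0 ltW.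
apply: le_trans (gauss_int_le kq).
by have [_] := @gauss_sum_bounds q^-1 k (ltac:(by rewrite invr_gt0)).
Qed.

Lemma sum_distinct_prob_ge0 n : 0 <= sum_distinct_prob n.
Proof. by apply: sumr_ge0 => l _; apply: distinct_prob_ge0. Qed.

(** Only the terms with l + 1 <= d N are kept; their Gaussian lower bounds have width
    sqrt ((1 - d) N), while their number exceeds sqrt N by far. *)
Lemma sum_distinct_prob_ge n (d : R) : 0 < d -> d < 1 ->
  gauss_half * Num.sqrt (2 * n.+1%:R) * (1 - d) - (1 + gauss_half) * (4 / d) - 1 <= sum_distinct_prob n.
Proof.
move=> d0 d1; have g0 := gauss_half_ge0; set N : R := n.+1%:R.
have N1 : 1 <= N by rewrite ler1n.
have N0 : 0 < N by apply: lt_le_trans N1.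
have dp : 0 < 1 - d by rewrite subr_gt0.
have sq0 : 0 <= Num.sqrt (2 * N) by rewrite sqrtr_ge0.
have [dN|dN] := ltP (d * N) 2.
  (* Here n is so small that the left-hand side is negative. *)
  have h : Num.sqrt (2 * N) <= 4 / d.
    apply: le_trans (_ : 2 * N <= _).
      rewrite -[leRHS]gtr0_norm ?mulr_gt0 // -sqrtr_sqr ler_sqrt ?sqr_ge0 //.
      by rewrite expr2 ler_peMr ?mulr_ge0 ?(ltW N0) //; lra.
    by rewrite ler_pdivlMr // mulrAC -mulrA; lra.
  have h2 : gauss_half * Num.sqrt (2 * N) * (1 - d) <= (1 + gauss_half) * (4 / d).
    apply: le_trans (_ : gauss_half * Num.sqrt (2 * N) <= _).
      by rewrite ler_piMr ?mulr_ge0 // lerBlDr lerDl ltW.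
    by apply: ler_pM => //; rewrite lerDr.
  by apply: le_trans (sum_distinct_prob_ge0 n); lra.
pose L := Num.truncn (d * N).
have Ld : L%:R <= d * N by rewrite -truncn_ge_nat ?mulr_ge0 ?ltW.
have LS : d * N < L%:R + 1 by rewrite natr1 truncnS_gt.
have Lhalf : d * N / 2 <= L%:R by lra.
have L0 : (0 : R) < L%:R by lra.
have Ln : (L <= n)%N.
  by rewrite -ltnS -(ltr_nat R); apply: le_lt_trans Ld _; rewrite gtr_pMl.
set q := Num.sqrt (2 * ((1 - d) * N)).
have q0 : 0 < q by rewrite sqrtr_gt0 !mulr_gt0.
have q2 : q ^+ 2 = 2 * ((1 - d) * N) by rewrite sqr_sqrtr // !mulr_ge0 // ltW.
have s1 : \sum_(l < L) gauss_fun (l.+1%:R * q^-1) <= sum_distinct_prob n.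
  apply: le_trans (_ : \sum_(l < L) distinct_prob n.+1 l <= _).
    apply: ler_sum => l _; apply: distinct_prob_ge_gauss => //.
    by apply: le_trans Ld; rewrite natr1 ler_nat.
  rewrite /sum_distinct_prob; move: (n.+1) => N'; rewrite -(subnKC Ln) big_split_ord /= lerDl.
  by apply: sumr_ge0 => l _; apply: distinct_prob_ge0.
have s2 : \sum_(l < L) gauss_fun (l%:R * q^-1) <= \sum_(l < L) gauss_fun (l.+1%:R * q^-1) + 1.
  have -> : \sum_(l < L) gauss_fun (l.+1%:R * q^-1) =
     \sum_(l < L.+1) gauss_fun (l%:R * q^-1) - gauss_fun (0%:R * q^-1).
    by rewrite big_ord_recl /= addrC addKr.
  rewrite big_ord_recr /= -addrA -addrA lerDl.
  have := gauss_fun_le1 (0%:R * q^-1); have := gauss_fun_ge0 (L%:R * q^-1); lra.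
have [s3 _] := @gauss_sum_bounds q^-1 L (ltac:(by rewrite invr_gt0)).
have s4 := @gauss_int_ge (L%:R * q^-1) (ltac:(by rewrite mulr_gt0 ?invr_gt0)).
have s5 : gauss_half * q - (1 + gauss_half) * (q ^+ 2 / L%:R) <= \sum_(l < L) gauss_fun (l%:R * q^-1).
  have := ler_wpM2l (ltW q0) (le_trans s4 s3); rewrite mulrA mulfV ?gt_eqF // mul1r.
  apply: le_trans; rewrite le_eqVlt; apply/orP; left; apply/eqP; field.
  by rewrite !gt_eqF.
have s6 : q ^+ 2 / L%:R <= 4 / d.
  rewrite q2 ler_pdivrMr //; apply: le_trans (_ : 4 / d * (d * N / 2) <= _); last first.
    by rewrite ler_wpM2l // divr_ge0 // ltW.
  have -> : 4 / d * (d * N / 2) = 2 * N by field; rewrite gt_eqF.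
  by rewrite ler_wpM2l // ler_piMl ?(ltW N0) // lerBlDr lerDl ltW.
have s7 : Num.sqrt (2 * N) * (1 - d) <= q.
  rewrite -(@ler_pXn2r _ 2) // ?nnegrE ?(ltW q0) ?mulr_ge0 ?(ltW dp) //.
  rewrite exprMn sqr_sqrtr ?mulr_ge0 ?(ltW N0) // q2 -mulrA ler_wpM2l //.
  rewrite mulrC ler_wpM2r ?(ltW N0) // expr2 ler_piMl ?(ltW dp) //.
  by rewrite lerBlDr lerDl ltW.
have s8 := ler_wpM2l g0 s7.
have s9 := ler_wpM2l (addr_ge0 ler01 g0) s6.
move: s8; rewrite mulrA; lra.
Qed.

End GaussSum.

(** * Asymptotics *)

Section Asymptotics.
Variable R : realType.

(** Linear growth with an additive error passes to expectations. *)
Lemma expectation_linear_growth n (a : nat -> R) c (e C : R) (k : {ffun 'I_n -> 'I_n} -> nat) :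
  (forall k, `|a k - c * k%:R| <= e * k%:R + C) ->
  `|uniform_expectation (parking_functions n) (fun f => a (k f)) -
    c * uniform_expectation (parking_functions n) (fun f => (k f)%:R)| <=
  e * uniform_expectation (parking_functions n) (fun f => (k f)%:R) + C.
Proof.
move=> h; have P0 : (0 : R) < #|parking_functions n|%:R by rewrite ltr0n card_parking_gt0.
rewrite /uniform_expectation (mulrA c) -mulrBl normrM (ger0_norm (_ : 0 <= _^-1)) ?invr_ge0 ?(ltW P0) //.
rewrite ler_pdivrMr // mulrDl mulrA divfK ?gt_eqF // mulr_sumr -sumrB.
apply: le_trans (ler_norm_sum _ _ _) _; apply: le_trans (ler_sum _ (fun f _ => h (k f))) _.
by rewrite big_split /= -mulr_sumr sumr_const mulr_natr.
Qed.

Lemma gauss_half_sqrt2 (N : R) : 0 <= N ->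
  gauss_half R * Num.sqrt (2 * N) = Num.sqrt (pi / 2) * Num.sqrt N.
Proof.
move=> N0; rewrite sqrtrM // mulrA; congr (_ * _).
have p0 : (0 : R) <= pi by apply: pi_ge0.
have s2 : Num.sqrt (2 : R) != 0 by rewrite gt_eqF // sqrtr_gt0.
rewrite sqrtrM // sqrtrV // /gauss_half; apply: (mulIf s2).
by rewrite -!mulrA -expr2 sqr_sqrtr // !mulVf.
Qed.

(** The Gaussian bounds involve sqrt (n + 1), which is within 1 of sqrt n. *)
Lemma sum_distinct_prob_sqrt n (d : R) : 0 < d -> d < 1 ->
  `|sum_distinct_prob R n - Num.sqrt (pi / 2) * Num.sqrt n%:R| <=
   d * (Num.sqrt (pi / 2) * Num.sqrt n%:R) +
   (1 + Num.sqrt (pi / 2) + (1 + gauss_half R) * (4 / d) + 1).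
Proof.
move=> d0 d1; set J := Num.sqrt (pi / 2); set s := Num.sqrt n%:R.
have J0 : 0 <= J := sqrtr_ge0 _. have s0 : 0 <= s := sqrtr_ge0 _.
have up := sum_distinct_prob_le R n; have lo := sum_distinct_prob_ge n d0 d1.
rewrite gauss_half_sqrt2 // -/J in up lo; set t := Num.sqrt _ in up lo.
have st : s <= t by rewrite ler_sqrt // ler_nat.
have ts : t <= s + 1.
  rewrite -(@ler_pXn2r _ 2) // ?nnegrE ?sqrtr_ge0 ?addr_ge0 // sqrrD1 sqr_sqrtr // sqr_sqrtr //.
  by rewrite -natr1 lerD2r lerDl mulrn_wge0.
have K0 : 0 <= (1 + gauss_half R) * (4 / d).
  by rewrite mulr_ge0 ?addr_ge0 ?gauss_half_ge0 // divr_ge0 // ltW.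
have h1 := ler_wpM2l J0 ts.
have h2 : J * s * (1 - d) <= J * t * (1 - d).
  by rewrite ler_wpM2r ?subr_ge0 ?(ltW d1) // ler_wpM2l.
have h3 : 0 <= d * (J * s) by rewrite !mulr_ge0 // ltW.
move: K0 lo; set K := (1 + gauss_half R) * (4 / d) => K0 lo.
rewrite mulrDr mulr1 in h1; rewrite ler_distl.
have h4 : J * s * (1 - d) = J * s - d * (J * s) by ring.
by apply/andP; split; lra.
Qed.

End Asymptotics.

Local Open Scope classical_set_scope.

Theorem theorem5p3 (R : realType) (r : nat) (hr : (1 <= r)%N) :
  (fun n : nat =>
     uniform_expectation (parking_functions n)
       (fun f => (longest_dicycle r f)%:R : R) / Num.sqrt (n%:R : R))
    @ \oo --> Num.sqrt (pi / 2 : R) * G1 R r.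
Proof.
have [c lg] := mean_len_linear R hr.
have cE : c = G1 R r by case: r hr lg => // i _; apply: mean_len_slope.
rewrite -{}cE; set J := Num.sqrt (pi / 2).
have J0 : 0 <= J := sqrtr_ge0 _.
apply/cvgrPdist_le => e e0.
have den : 0 < J * (2 + `|c|) + 1 by rewrite ltr_wpDl // mulr_ge0 // addr_ge0.
(* Chosen so that all errors proportional to sqrt n add up to at most (e / 2) sqrt n;
   the bounded errors D are below that as soon as n is large. *)
pose d := Num.min 2^-1 (e / 2 / (J * (2 + `|c|) + 1)).
have d0 : 0 < d by rewrite lt_min invr_gt0 ltr0n /= !divr_gt0.
have d1 : d < 1 by rewrite gt_min invf_lt1 ?ltr0n // ltr1n.
have dJ : d * (J * (2 + `|c|)) <= e / 2.
  apply: le_trans (_ : d * (J * (2 + `|c|) + 1) <= _); first by rewrite ler_wpM2l ?(ltW d0) // lerDl.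
  by rewrite -ler_pdivlMr // ge_min lexx orbT.
have [C hC] := lg d d0.
pose K := 1 + J + (1 + gauss_half R) * (4 / d) + 1.
pose D := d * K + `|C| + `|c| * K.
have K0 : 0 <= K.
  by rewrite !addr_ge0 // mulr_ge0 ?addr_ge0 ?gauss_half_ge0 // divr_ge0 // ltW.
near=> n.
have n0 : (0 : R) < n%:R by rewrite ltr0n; near: n; exists 1%N.
set s := Num.sqrt n%:R; have s0 : 0 < s by rewrite sqrtr_gt0.
have sD : D <= e / 2 * s.
  rewrite mulrC -ler_pdivrMr ?divr_gt0 //.
  apply: le_trans (ler_norm _) _; rewrite -sqrtr_sqr ler_sqrt ?(ltW n0) //.
  by near: n; exact: nbhs_infty_ger.
set X := uniform_expectation _ _.
pose E := sum_distinct_prob R n.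
have XE : `|X - c * E| <= d * E + C.
  have := expectation_linear_growth (fun f : {ffun 'I_n -> 'I_n} => #|cyclic_points f|) hC.
  by rewrite /X expected_longest_dicycle // expected_cyclic_points.
have EJ := sum_distinct_prob_sqrt n d0 d1; rewrite -/J -/s -/E -/K in EJ.
rewrite distrC -(ler_pM2r s0) -[X in `|_| * X <= _](gtr0_norm s0) -normrM mulrBl divfK ?gt_eqF //.
have -> : X - J * c * s = (X - c * E) + c * (E - J * s) by ring.
apply: le_trans (ler_normD _ _) _; rewrite normrM.
have E2 : E <= J * s + d * (J * s) + K by move: EJ; rewrite ler_distl; lra.
have cEJ := ler_wpM2l (normr_ge0 c) EJ.
have dE := ler_wpM2l (ltW d0) E2.
have Js0 : 0 <= J * s by rewrite mulr_ge0 // ltW.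
have ddJ : d * (d * (J * s)) <= d * (J * s).
  by rewrite ler_piMl ?(ltW d1) // mulr_ge0 // ltW.
have dJs := ler_wpM2r (ltW s0) dJ.
have C1 := ler_norm C.
apply: le_trans (_ : d * (J * (2 + `|c|)) * s + D <= _); last by lra.
apply: le_trans (lerD XE cEJ) _.
have -> : d * (J * (2 + `|c|)) * s + D =
   (d * (J * s) + d * (J * s) + d * K + `|C|) + `|c| * (d * (J * s) + K).
  by rewrite /D; ring.
by rewrite lerD2r; move: dE; rewrite !mulrDr; lra.
Unshelve. all: by end_near. Qed.
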